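(* For all $n\ge 1$, $$\omega W^<_n(\mathbf{x},t)=\sum_{\substack{\sigma\in\mathfrak{S}_n\\ \sigma(1)<\sigma(n)}} t^{\mathrm{des}(\sigma)}F_{n,\mathrm{DES}_{\ge2}(\sigma^{-1})}(\mathbf{x})$$ and $$\omega W^>_n(\mathbf{x},t)=\sum_{\substack{\sigma\in\mathfrak{S}_n\\ \sigma(1)>\sigma(n)}} t^{\mathrm{des}(\sigma)}F_{n,\mathrm{ASC}_{\ge2}(\sigma^{-1})}(\mathbf{x}).$$
   Context: For $n\ge 1$, $W_n$ is the set of Smirnov words of length $n$: words $w=w_1\cdots w_n$ over the positive integers with $w_i\ne w_{i+1}$ for all $1\le i\le n-1$. Let $\mathbf{x}=x_1,x_2,\dots$ be indeterminates and $x_w:=x_{w_1}\cdots x_{w_n}$. The descent number of a word or permutation is $\mathrm{des}(w):=|\{i\in\{1,\dots,n-1\}: w_i>w_{i+1}\}|$ (for $\sigma\in\mathfrak{S}_n$ use the word $\sigma(1)\cdots\sigma(n)$). Define $W^<_n(\mathbf{x},t):=\sum_{w\in W_n,\,w_1<w_n} t^{\mathrm{des}(w)}x_w$ and $W^>_n(\mathbf{x},t):=\sum_{w\in W_n,\,w_1>w_n} t^{\mathrm{des}(w)}x_w$; these are polynomials in $t$ with symmetric function coefficients. $\omega$ is the standard involution on symmetric functions taking $e_n$ to $h_n$, applied coefficientwise in $t$. For $S\subseteq\{1,\dots,n-1\}$, the fundamental quasisymmetric function is $F_{n,S}(\mathbf{x}):=\sum_f x_{f(1)}\cdots x_{f(n)}$,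 summed over all functions $f:\{1,\dots,n\}\to\{1,2,3,\dots\}$ with $f(i)\ge f(i+1)$ for all $i\in\{1,\dots,n-1\}$ and $f(i)>f(i+1)$ for all $i\in S$. For $\sigma\in\mathfrak{S}_n$, $\mathrm{DES}_{\ge2}(\sigma):=\{i\in\{1,\dots,n-1\}:\sigma(i)-\sigma(i+1)\ge2\}$ and $\mathrm{ASC}_{\ge2}(\sigma):=\{i\in\{1,\dots,n-1\}:\sigma(i+1)-\sigma(i)\ge2\}$. *)

(* Defs.v *)
From HB Require Import structures.
From mathcomp Require Import all_boot all_order all_algebra all_fingroup.
From mathcomp Require Import finmap multiset.
From mathcomp Require Import boolp classical_sets functions cardinality fsbigop.
From mathcomp Require Import mpoly.

Set Implicit Arguments.
Unset Strict Implicit.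
Unset Printing Implicit Defensive.

Import GRing.Theory.

Local Open Scope mset_scope.
Local Open Scope ring_scope.

(* The ring Z[[x_1, x_2, ...]]. The letter (or variable index) i : nat stands *)
(* for the positive integer i + 1: words are over nat, and x_1 is xvar 0.     *)
(* A monomial is the multiset of the indices of its variables; a series maps  *)
(* each monomial to its coefficient.                                          *)
Definition fps : Type := {mset nat} -> int.

HB.instance Definition _ := GRing.Zmodule.copy fps ({mset nat} -> int).

Lemma fps_addE (f g : fps) m : (f + g) m = f m + g m.
Proof. by []. Qed.

Definition fps_one : fps := fun m => (m == mset0)%:R.

Definition fps_mul (f g : fps) : fps := fun m =>
  \sum_(a \in [set a : {mset nat} | (a `<=` m)%mset]) f a * g (m `\` a)%mset.

Definition msubs (m : {mset nat}) : seq {mset nat} :=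
  undup [seq seq_mset (mask (b : bitseq) m) | b : (size m).-tuple bool].

Lemma mem_msubs (m a : {mset nat}) : (a \in msubs m) = (a `<=` m)%mset.
Proof.
rewrite mem_undup; apply/idP/idP => [/mapP[b _ ->]|/msubsetP am].
  apply/msubsetP => x; rewrite mset_seqE -count_mem_mset.
  by apply: leq_count_subseq; apply: mask_subseq.
have /count_subseqP[s /subseqP[b sb ->] pa] :
    forall x, (count_mem x a <= count_mem x m)%N.
  by move=> x; rewrite !count_mem_mset.
apply/mapP; exists (tcast sb (in_tuple b)); first by rewrite mem_enum.
by rewrite val_tcast -(seq_mset_id a); apply/eq_seq_msetP.
Qed.

Lemma fps_mulE (f g : fps) m :
  fps_mul f g m = \sum_(a <- msubs m) f a * g (m `\` a)%mset.
Proof.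
rewrite /fps_mul (_ : [set a | _]%classic = [set` msubs m]%classic); last first.
  by apply/seteqP; split=> a /=; rewrite mem_msubs.
by rewrite -fsbig_seq ?undup_uniq.
Qed.

Lemma msubs_uniq m : uniq (msubs m). Proof. exact: undup_uniq. Qed.

Lemma msetBBK (a m : {mset nat}) : (a `<=` m)%mset -> (m `\` (m `\` a) = a)%mset.
Proof. by move/msubsetP => am; apply/msetP => x; rewrite !msetE2 subKn. Qed.

Lemma msetB_sub (a m : {mset nat}) : (m `\` a `<=` m)%mset.
Proof. by apply/msubsetP => x; rewrite msetE2 leq_subr. Qed.

Lemma fps_mulC : commutative fps_mul.
Proof.
move=> f g; apply/funext => m; rewrite !fps_mulE.
have pm : perm_eq (msubs m) [seq (m `\` a)%mset | a <- msubs m].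
  apply: uniq_perm; rewrite ?msubs_uniq //.
    rewrite map_inj_in_uniq ?msubs_uniq // => a b; rewrite !mem_msubs => am bm.
    by move=> /(congr1 (msetB m)); rewrite !msetBBK.
  move=> a; rewrite mem_msubs; apply/idP/mapP => [am|[b _ ->]].
    by exists (m `\` a)%mset; rewrite ?msetBBK // mem_msubs msetB_sub.
  exact: msetB_sub.
rewrite (perm_big _ pm) big_map big_seq [RHS]big_seq.
by apply: eq_bigr => a; rewrite mem_msubs => am; rewrite msetBBK // mulrC.
Qed.

Lemma fps_mulA : associative fps_mul.
Proof.
move=> f g h; apply/funext => m; rewrite !fps_mulE.
transitivity (\sum_(a <- msubs m) \sum_(c <- msubs m | (a `<=` c)%mset)
    f a * g (c `\` a)%mset * h (m `\` c)%mset).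
  rewrite big_seq [RHS]big_seq; apply: eq_bigr => a; rewrite mem_msubs => am.
  rewrite fps_mulE mulr_sumr -[RHS]big_filter.
  have pm : perm_eq [seq c <- msubs m | (a `<=` c)%mset]
      [seq (a `+` b)%mset | b <- msubs (m `\` a)%mset].
    apply: uniq_perm; rewrite ?filter_uniq ?msubs_uniq //.
      rewrite map_inj_uniq ?msubs_uniq //.
      exact: can_inj (msetDKB a).
    move=> c; rewrite mem_filter mem_msubs; apply/andP/mapP.
      move=> [/msubsetP ac /msubsetP cm]; exists (c `\` a)%mset.
        rewrite mem_msubs; apply/msubsetP => x; rewrite !msetE2.
        exact: leq_sub2r.
      by apply/msetP => x; rewrite !msetE2 subnKC.
    move=> [b]; rewrite mem_msubs => /msubsetP bm ->; move/msubsetP: am => am.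
    split; apply/msubsetP => x; rewrite !msetE2 ?leq_addr //.
    by have := bm x; rewrite !msetE2 leq_subRL ?am.
  rewrite (perm_big _ pm) big_map; apply: eq_bigr => b _.
  by rewrite msetDKB msetBDA mulrA.
under eq_bigr do rewrite big_mkcond /=.
rewrite exchange_big /= big_seq [RHS]big_seq; apply: eq_bigr => c.
rewrite mem_msubs => cm; rewrite fps_mulE mulr_suml -big_mkcond -big_filter.
apply: perm_big; apply: uniq_perm; rewrite ?filter_uniq ?msubs_uniq //.
move=> a; rewrite mem_filter !mem_msubs andb_idr // => ac.
exact: msubset_trans ac cm.
Qed.

Lemma fps_mul1 : left_id fps_one fps_mul.
Proof.
move=> f; apply/funext => m; rewrite fps_mulE.
have m0 : mset0 \in msubs m.
  by rewrite mem_msubs; apply/msubsetP => x; rewrite mset0E.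
rewrite (bigD1_seq mset0) ?msubs_uniq //= big1_seq => [|a /andP[a0 _]].
  rewrite /fps_one eqxx mul1r addr0; congr f.
  by apply/msetP => x; rewrite !msetE2 mset0E subn0.
by rewrite /fps_one (negPf a0) mul0r.
Qed.

Lemma fps_mulDl : left_distributive fps_mul +%R.
Proof.
move=> f g h; apply/funext => m.
rewrite fps_addE !fps_mulE -big_split /=.
by apply: eq_bigr => a _; rewrite fps_addE mulrDl.
Qed.

Lemma fps_one_neq0 : fps_one != 0 :> fps.
Proof.
by apply/eqP => /(congr1 (fun f : fps => f mset0)); rewrite /fps_one eqxx.
Qed.

HB.instance Definition _ := GRing.Zmodule_isComNzRing.Build fps
  fps_mulA fps_mulC fps_mul1 fps_mulDl fps_one_neq0.

Definition xvar (i : nat) : fps := fun m => (m == [mset i])%:R.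

(* x_w = x_{w_1} ... x_{w_n} *)
Definition xw (w : seq nat) : fps := \prod_(i <- w) xvar i.

(* The (generally infinite) sum of the x_w for w in A, taken coefficientwise. *)
(* Every A below consists of words of one fixed length, so that only finitely *)
(* many w contribute to a given coefficient.                                  *)
Definition xsum (A : set (seq nat)) : fps := fun m => \sum_(w \in A) xw w m.

(* Elementary and complete homogeneous symmetric functions.                   *)
Definition esf (k : nat) : fps := xsum [set w | size w = k /\ sorted ltn w]%classic.
Definition hsf (k : nat) : fps := xsum [set w | size w = k /\ sorted leq w]%classic.

(* The symmetric functions form the ring Z[e_1, e_2, ...], freely generated   *)
(* by the e_k, and omega is its ring endomorphism with e_k |-> h_k: it sends  *)
(* P(e_1, ..., e_k) to P(h_1, ..., h_k) for every integer polynomial P (and,  *)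
(* by convention, a series that is not a symmetric function to 0).            *)
Definition omega (f : fps) : fps :=
  xget 0 [set g : fps | exists k (P : {mpoly int[k]}),
    f = mmap intr (fun i : 'I_k => esf i.+1) P /\
    g = mmap intr (fun i : 'I_k => hsf i.+1) P]%classic.

(* Throughout, the position i : 'I_n.-1 stands for i + 1 in {1, ..., n - 1}.  *)
Definition des (w : seq nat) : nat :=
  #|[set i : 'I_(size w).-1 | (nth 0 w i.+1 < nth 0 w i)%N]|.

Definition smirnov (n : nat) : set (seq nat) :=
  [set w | size w = n /\ forall i : 'I_n.-1, nth 0%N w i != nth 0%N w i.+1]%classic.

(* Polynomials in t = 'X; the coefficient of t^d collects the words with d    *)
(* descents, and a word of length n >= 1 has fewer than n descents.           *)
Definition Wlt (n : nat) : {poly fps} :=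
  \poly_(d < n) xsum [set w | smirnov n w /\
    (head 0 w < last 0 w)%N /\ des w = d]%classic.

Definition Wgt (n : nat) : {poly fps} :=
  \poly_(d < n) xsum [set w | smirnov n w /\
    (head 0 w > last 0 w)%N /\ des w = d]%classic.

Definition Fqsym (n : nat) (S : {set 'I_n.-1}) : fps :=
  xsum [set f | size f = n /\ forall i : 'I_n.-1,
    (nth 0 f i.+1 <= nth 0 f i)%N /\
    (i \in S -> (nth 0 f i.+1 < nth 0 f i)%N)]%classic.

(* The word sigma(1) ... sigma(n), with values shifted to 0, ..., n - 1.      *)
Definition pword (n : nat) (s : 'S_n) : seq nat :=
  [seq (s i : nat) | i <- enum 'I_n].

Definition DESge2 (n : nat) (s : 'S_n) : {set 'I_n.-1} :=
  [set i : 'I_n.-1 | (nth 0 (pword s) i.+1 + 2 <= nth 0 (pword s) i)%N].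

Definition ASCge2 (n : nat) (s : 'S_n) : {set 'I_n.-1} :=
  [set i : 'I_n.-1 | (nth 0 (pword s) i + 2 <= nth 0 (pword s) i.+1)%N].

(* Main.v *)
From HB Require Import structures.
Require Import Defs.
From mathcomp Require Import all_boot all_order all_algebra all_fingroup.
From mathcomp Require Import finmap multiset.
From mathcomp Require Import boolp classical_sets functions cardinality fsbigop.
From mathcomp Require Import mpoly.
From mathcomp Require Import ring zify.

(* On the alphabet {1, ..., N} put A_ij = x_i (t [i > j] + [i < j]). The trace
   of A^(n-1) dA/dt is W^<_n (dA/dt marks the step from w_n back to w_1), and
   Jacobi's formula for the derivative of q(z) = det(1 - z A) gives
   q(z) * sum_n W^<_n z^n = - dq/dt. The determinant is explicit:
   (1 - t) q(z) = E(tz) - t E(z), with E(z) = sum_k e_k z^k. This is a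
   recursion
     W^<_n = sum_(k<n) a_k e_k W^<_(n-k) + (d a_n/dt) e_n,
   where a_k = t + ... + t^(k-1).

   On the other side, grouping the terms (sigma, f) of the right hand side by
   c = f o sigma and D = the descent set of sigma turns it into a sum over words
   c and sets D, other than the set of all positions, such that
   c_p <= c_(p+1) for p in D, c_p >= c_(p+1) for p not in D, and c_1 >= c_n.
   Conversely sigma sorts the positions by decreasing c, then by increasing
   block, then decreasingly, where a block is a maximal run of positions linked
   by p in D and c_p = c_(p+1). The matrix x_i (t [i <= j] + [i >= j]), corrected
   for D = everything by x_i t [i <= j], then gives the same recursion with h_k
   in place of e_k. By induction, omega exchanges both sides. It is well defined
   because the e_k are algebraically independent.

   The statement for W^> follows by reversing words and permutations. *)

Set Implicit Arguments.
Unset Strict Implicit.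
Unset Printing Implicit Defensive.

Import GRing.Theory.

(** * Permutations from descent sets *)

Section Blocks.
Variable linked : nat -> bool.

(* The first position of the maximal run of linked positions ending at [p]. *)
Fixpoint block_start p :=
  if p is q.+1 then if linked q then block_start q else p else 0.

Lemma block_start_le p : block_start p <= p.
Proof. by elim: p => //= p IH; case: ifP => // _; apply: leqW. Qed.

Lemma block_start_linked p q : block_start q <= p -> p < q -> linked p.
Proof.
elim: q => //= q IH; rewrite ltnS [p <= q]leq_eqVlt; case: ifP => [lq|_].
  by move=> bp /predU1P[->|/IH->].
by move=> qp pq; exfalso; lia.
Qed.

Lemma block_start_same p q :
  block_start q <= p -> p <= q -> block_start p = block_start q.
Proof.
elim: q => [|q IH] /=; first by rewrite leqn0 => _ /eqP->.
rewrite [p <= _]leq_eqVlt ltnS; case: ifP => [lq|lq] bp /predU1P[->|pq] /=; rewrite ?lq //.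
  exact: IH.
by exfalso; lia.
Qed.

Variable c : nat -> nat.

(** Lexicographic order on the keys (-c, block start, -position); strict and total, since the key
    contains the position. *)
Definition key_lt p q := (c q < c p) || ((c p == c q) &&
  ((block_start p < block_start q) ||
   ((block_start p == block_start q) && (q < p)))).

Lemma key_lt_irr p : key_lt p p = false.
Proof. rewrite /key_lt; lia. Qed.

Lemma key_lt_trans q p r : key_lt p q -> key_lt q r -> key_lt p r.
Proof. rewrite /key_lt; lia. Qed.

Lemma key_lt_total p q : p != q -> ~~ key_lt p q -> key_lt q p.
Proof. rewrite /key_lt; lia. Qed.

End Blocks.

Section DescentSets.
Variable m : nat.
Implicit Types (s : 'S_m.+1) (D : {set 'I_m}).

Local Notation wid := (widen_ord (leqnSn m)).
Local Notation nxt := (lift (@ord0 m)).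

Definition Des s := [set i : 'I_m | s (nxt i) < s (wid i)].

(** Membership is extended by [false] to [nat], because [block_start] takes a predicate on natural
    numbers. *)
Definition mem_nat D p := if insub p is Some i then i \in D else false.

Lemma mem_natE D (i : 'I_m) : mem_nat D i = (i \in D).
Proof. by rewrite /mem_nat valK. Qed.

Variable c : nat -> nat.

Definition slinked D p := mem_nat D p && (c p == c p.+1).

Local Notation "p '\before[' D ] q" := (key_lt (slinked D) c p q)
  (at level 70, D at level 0, q at next level).

Definition krank D (p : 'I_m.+1) : 'I_m.+1 :=
  inord #|[set q : 'I_m.+1 | q \before[D] p]|.

Lemma val_krank D p : krank D p = #|[set q : 'I_m.+1 | q \before[D] p]| :> nat.
Proof.
rewrite inordK //.
have /subset_leq_card : [set q : 'I_m.+1 | q \before[D] p] \subset [set~ p].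
  by apply/fintype.subsetP => q; rewrite !inE; apply: contraTneq => ->; rewrite key_lt_irr.
by rewrite cardsC1 card_ord.
Qed.

Lemma ltn_krank D (p q : 'I_m.+1) : p \before[D] q -> krank D p < krank D q.
Proof.
move=> pq; rewrite !val_krank; apply: proper_card; apply/properP; split.
  by apply/fintype.subsetP => r; rewrite !inE => /key_lt_trans; apply.
by exists p; rewrite !inE ?key_lt_irr.
Qed.

Lemma krankE D (p q : 'I_m.+1) : (krank D p < krank D q) = (p \before[D] q).
Proof.
apply/idP/idP => [|/ltn_krank //]; apply: contraTT => npq.
case: (eqVneq p q) => [->|pq]; first by rewrite ltnn.
by rewrite -leqNgt; apply/ltnW/ltn_krank/key_lt_total.
Qed.

Lemma krank_inj D : injective (krank D).
Proof.
move=> p q e; apply/eqP/negPn/negP => pq.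
have := krankE D p q; rewrite e ltnn => /esym/negbT/(key_lt_total pq).
by rewrite -krankE e ltnn.
Qed.

Definition perm_of_Des D : 'S_m.+1 := perm (@krank_inj D).

Lemma perm_of_DesE D (p q : 'I_m.+1) : (perm_of_Des D p < perm_of_Des D q) = (p \before[D] q).
Proof. by rewrite !permE krankE. Qed.

(** For f = c o s^-1, the second condition is the one that [Fqsym] imposes for the set
    [DESge2 (s^-1)]; [p] and [q] are the positions of two consecutive values. *)
Definition good_perm s := (s ord0 < s ord_max) &&
  [forall i : 'I_m, let p := (s^-1)%g (wid i) in let q := (s^-1)%g (nxt i) in
     (c q <= c p) && ((q + 2 <= p) ==> (c q < c p))].

Definition compat D := [&& c m <= c 0, D != [set: 'I_m]%SET &
  [forall i : 'I_m, if i \in D then c i <= c i.+1 else c i.+1 <= c i]].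

Lemma Des_decr s (p q : 'I_m.+1) : p < q ->
  (forall r, p <= r < q -> mem_nat (Des s) r) -> s q < s p.
Proof.
case: q => q /= qm; elim: q qm => // q IH qm; rewrite ltnS => pq hr.
have qm' : q < m by [].
have sq : s (Ordinal qm) < s (Ordinal (ltnW qm)).
  have := hr q; rewrite pq ltnSn => /(_ isT).
  rewrite -[q]/(nat_of_ord (Ordinal qm')) mem_natE inE.
  by congr (s _ < s _); apply: val_inj.
move: pq; rewrite leq_eqVlt => /predU1P[e|pq].
  by rewrite (_ : p = Ordinal (ltnW qm)) //; apply: val_inj.
apply: ltn_trans sq _; apply: IH => // r /andP[pr rq]; apply: hr.
by rewrite pr ltnW.
Qed.

(** Only c p = c q needs an argument, and then q + 2 <= p is excluded. If p = q + 1, position q is a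
    descent linked to p, and the later position of a block comes first. If p < q, a common block
    would make s decrease from p to q, against s p < s q. *)
Lemma good_key_step s (i : 'I_m) : good_perm s ->
  (s^-1)%g (wid i) \before[(Des s)] (s^-1)%g (nxt i).
Proof.
move=> /andP[_ /forallP /(_ i)] /=.
set p := (s^-1)%g (wid i); set q := (s^-1)%g (nxt i).
have sp : s p = i :> nat by rewrite permKV.
have sq : s q = i.+1 :> nat by rewrite permKV.
have pq : p != q :> nat.
  by apply: contra_eq_neq sp => e; rewrite (_ : p = q) ?sq //; [lia|exact: val_inj].
move=> /andP[cqp strict].
move: (cqp); rewrite leq_eqVlt => /predU1P[e|lt]; last by rewrite /key_lt lt.
move: strict; rewrite e ltnn implybF -ltnNge addn2 ltnS leq_eqVlt => /predU1P[pq1|].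
  have qm : q < m by rewrite -ltnS -pq1.
  have lq : slinked (Des s) q.
    rewrite /slinked -pq1 e eqxx andbT -[nat_of_ord q]/(nat_of_ord (Ordinal qm)).
    rewrite mem_natE inE (_ : nxt _ = p); last exact/val_inj/esym.
    by rewrite (_ : wid _ = q) ?sp ?sq //; exact: val_inj.
  have bs : block_start (slinked (Des s)) p = block_start (slinked (Des s)) q.
    by rewrite pq1 /= lq.
  by rewrite /key_lt bs e; lia.
rewrite ltnS => qp; have {qp pq} qp : p < q by lia.
rewrite /key_lt e eqxx ltnn /=; apply/orP; left.
rewrite ltnNge; apply/negP => bqp.
have : s q < s p.
  apply: Des_decr => // r /andP[pr rq].
  have := block_start_linked (leq_trans (leq_trans bqp (block_start_le _ _)) pr) rq.
  by case/andP.
by rewrite sp sq; lia.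
Qed.

Lemma good_key s : good_perm s -> forall p q : 'I_m.+1, (s p < s q) = (p \before[(Des s)] q).
Proof.
move=> gs.
have mono (p q : 'I_m.+1) : s p < s q -> p \before[(Des s)] q.
  move=> /subnKC; move: (s q - _) => k; elim: k q => [|k IH] q.
    rewrite addn0 => e; have pm : s p < m by rewrite -ltnS e.
    have := good_key_step (Ordinal pm) gs.
    by congr (_ \before[_] _); congr (nat_of_ord _); apply: (@perm_inj _ s);
      rewrite permKV; apply: val_inj.
  rewrite addnS => e; have km : (s p).+1 + k < m by rewrite -ltnS e.
  pose r := (s^-1)%g (wid (Ordinal km)).
  apply: (key_lt_trans (IH r _)); first by rewrite permKV.
  have := good_key_step (Ordinal km) gs.
  by congr (_ \before[_] _); congr (nat_of_ord _); apply: (@perm_inj _ s);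
    rewrite permKV; apply: val_inj.
move=> p q; apply/idP/idP => [/mono //|]; apply: contraTT.
case: (eqVneq p q) => [->|pq]; first by rewrite key_lt_irr.
rewrite -leqNgt leq_eqVlt => /predU1P[/val_inj/perm_inj e|/mono qp].
  by rewrite e eqxx in pq.
by apply/negP => /(key_lt_trans qp); rewrite key_lt_irr.
Qed.

Lemma card_ord_lt n k : k <= n -> #|[set i : 'I_n | i < k]| = k.
Proof.
by move=> kn; rewrite -sum1dep_card (big_ord_narrow kn) sum1_card card_ord.
Qed.

(** By [good_key], the rank of p counts the positions whose value is below s p, and there are s p of
    them. *)
Lemma perm_of_Des_good s : good_perm s -> perm_of_Des (Des s) = s.
Proof.
move=> gs; apply/permP => p; rewrite permE; apply: val_inj; rewrite /= val_krank.
rewrite -[RHS](card_ord_lt (ltnW (ltn_ord (s p)))) -[RHS](card_preimset _ (@perm_inj _ s)).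
by apply: eq_card => q; rewrite !inE good_key.
Qed.

Lemma good_compat s : good_perm s -> compat (Des s).
Proof.
move=> gs; have := gs => /andP[s0m _]; apply/and3P; split.
- by move: s0m; rewrite good_key // /key_lt /=; case: ltngtP.
- apply/eqP => DT; move: s0m; rewrite ltnNge => /negP; apply.
  case: (posnP m) => [m0|m_gt0]; first by rewrite (_ : ord_max = ord0) //; apply: val_inj.
  apply/ltnW/Des_decr => // r /andP[_ rm].
  by rewrite -[r]/(nat_of_ord (Ordinal rm)) mem_natE DT inE.
- apply/forallP => i; rewrite inE.
  have := good_key gs (nxt i) (wid i); have := good_key gs (wid i) (nxt i).
  rewrite /key_lt !lift0 /=.
  by case: ltngtP => [||/val_inj/perm_inj/(congr1 val) /=]; lia.
Qed.

Lemma compat_Des D : compat D -> Des (perm_of_Des D) = D.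
Proof.
move=> /and3P[_ _ /forallP h]; apply/finset.setP => i; rewrite inE perm_of_DesE.
have := h i; rewrite /key_lt !lift0 /=.
have -> : slinked D i = (i \in D) && (c i == c i.+1) by rewrite /slinked mem_natE.
(* If i is not linked, i + 1 opens a block later than that of i; if it is linked, both share a block
   and i + 1 comes first. *)
have := block_start_le (slinked D) i; move: (block_start _ i) => b.
by case: (i \in D); rewrite /= ?[c i.+1 == c i]eq_sym; case: (ltngtP (c i) (c i.+1)) => //=; lia.
Qed.

Lemma compat_good D : compat D -> good_perm (perm_of_Des D).
Proof.
move=> /and3P[c0m DT hD]; set s := perm_of_Des D.
apply/andP; split.
  rewrite perm_of_DesE /key_lt /=.
  move: c0m; rewrite leq_eqVlt => /predU1P[e|-> //]; rewrite e eqxx ltnn /=.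
  (* If c agrees at both ends, the last block cannot start at 0: all positions would be linked and D
     would be full. *)
  apply/orP; left; rewrite lt0n; apply: contraNneq DT => b0.
  apply/eqP/finset.setP => i; rewrite inE -mem_natE.
  by have := @block_start_linked (slinked D) i m; rewrite b0 => /(_ isT (ltn_ord i)) /andP[].
apply/forallP => i; set p := (s^-1)%g (wid i); set q := (s^-1)%g (nxt i).
have sp : s p = i :> nat by rewrite permKV.
have sq : s q = i.+1 :> nat by rewrite permKV.
have pq : p \before[D] q by rewrite -perm_of_DesE -/s sp sq.
apply/andP; split; first by move: pq; rewrite /key_lt; lia.
apply/implyP => qp; move: (pq); rewrite /key_lt => /orP[//|/andP[/eqP e] bpq].
have qn : q.+1 < m.+1 by have := ltn_ord p; lia.
(* When c p = c q, position r = q + 1 lies in the block shared by p and q, so the key order puts it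
   strictly between them, although s p and s q are consecutive values. *)
pose r := Ordinal qn.
have bq := block_start_le (slinked D) q.
have bpq' : block_start (slinked D) p <= block_start (slinked D) q by lia.
have bqp : block_start (slinked D) q = block_start (slinked D) p.
  by apply: block_start_same; lia.
have brp : block_start (slinked D) r = block_start (slinked D) p.
  by apply: block_start_same => /=; lia.
have cr : c r = c q.
  have : slinked D q by apply: (block_start_linked (q := p)); lia.
  by case/andP => _ /eqP.
have : p \before[D] r by rewrite /key_lt brp cr e eqxx /=; lia.
have : r \before[D] q by rewrite /key_lt brp cr bqp eqxx /=; lia.
rewrite -!perm_of_DesE -/s sp sq; lia.
Qed.

Lemma sum_good_perm (V : nmodType) (F : {set 'I_m} -> V) :
  (\sum_(s | good_perm s) F (Des s) = \sum_(D | compat D) F D)%R.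
Proof.
rewrite (reindex_onto perm_of_Des Des) /=; last exact: perm_of_Des_good.
apply: eq_big => [D|D /andP[_ /eqP-> //]].
apply/andP/idP => [[g /eqP <-]|cD]; first exact: good_compat.
by rewrite compat_good // compat_Des.
Qed.

End DescentSets.

Local Open Scope mset_scope.
Local Open Scope ring_scope.

(** * Determinants and traces of powers *)

Lemma Leibniz1 (S : comNzRingType) (D : {additive S -> S}) :
  (forall a b, D (a * b) = D a * b + a * D b) -> D 1 = 0.
Proof.
move=> DM; have /eqP := DM 1 1.
by rewrite !mul1r mulr1 -subr_eq0 opprD addNKr oppr_eq0 => /eqP.
Qed.

Lemma Leibniz_prod (S : comNzRingType) (D : {additive S -> S}) (I : finType)
    (f : I -> S) :
  (forall a b, D (a * b) = D a * b + a * D b) ->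
  D (\prod_i f i) = \sum_i D (f i) * \prod_(j | j != i) f j.
Proof.
move=> DM; have D1 := Leibniz1 DM.
have gen (r : seq I) : uniq r ->
    D (\prod_(i <- r) f i) = \sum_(i <- r) D (f i) * \prod_(j <- r | j != i) f j.
  elim: r => [|x r IH] /=; first by rewrite !big_nil D1.
  move=> /andP[xr ur]; rewrite !big_cons DM IH // eqxx /=; congr (_ * _ + _).
    rewrite [RHS]big_seq_cond [LHS]big_seq; apply: eq_bigl => i.
    by case: (eqVneq i x) => [->|]; rewrite ?(negPf xr) ?andbT.
  rewrite mulr_sumr [LHS]big_seq [RHS]big_seq; apply: eq_bigr => i ir.
  rewrite big_cons; case: (eqVneq x i) => [e|_]; first by rewrite e ir in xr.
  by rewrite mulrCA.
exact: gen _ (index_enum_uniq I).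
Qed.

(** Jacobi's formula. The Leibniz rule differentiates one row at a time, and expansion along that
    row yields the entries of the adjugate. *)
Lemma Leibniz_det (S : comNzRingType) (D : {additive S -> S}) n (B : 'M[S]_n) :
  (forall a b, D (a * b) = D a * b + a * D b) ->
  D (\det B) = \tr (\adj B *m map_mx D B).
Proof.
move=> DM.
pose Bi i := \matrix_(k, j) (if k == i then D (B k j) else B k j).
transitivity (\sum_i \det (Bi i)).
  rewrite /determinant raddf_sum exchange_big /=; apply: eq_bigr => s _.
  transitivity ((-1) ^+ s * D (\prod_i B i (s i))).
    by case: (s : bool); rewrite ?mulN1r ?mul1r ?raddfN.
  rewrite (Leibniz_prod _ DM) mulr_sumr; apply: eq_bigr => i _; congr (_ * _).
  rewrite [RHS](bigD1 i) //= mxE eqxx; congr (_ * _).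
  by apply: eq_bigr => j /negPf ji; rewrite mxE ji.
rewrite mxtrace_mulC; apply: eq_bigr => i _.
rewrite (expand_det_row _ i) mxE; apply: eq_bigr => j _.
rewrite !mxE eqxx; congr (_ * (_ * \det _)).
by apply/matrixP => k l; rewrite !mxE eq_sym (negPf (neq_lift _ _)).
Qed.

(* [y * 1] is a rank one matrix, so [det (B + s y 1)] is affine in [s]; it is
   triangular at [s = - a] and [s = - b]. *)
Lemma det_two_constants (S : comNzRingType) n (d y : 'I_n -> S) (a b : S) :
  let B := \matrix_(i, j) (if i == j then d i else
              if (i < j)%N then y i * a else y i * b) in
  (b - a) * \det B =
    b * \prod_i (d i - a * y i) - a * \prod_i (d i - b * y i).
Proof.
move=> B; pose x : 'cV[S]_n := \col_i y i; pose one : 'rV[S]_n := const_mx 1.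
pose F s : 'M[S]_n := \matrix_(i, j) (B i j + s * y i).
(* Bordering confines s to the first row: [F s] is the Schur complement, so linearity in that row
   makes its determinant affine in s. *)
pose G s : 'M[S]_(1 + n) := block_mx 1%:M (- s *: one) x B.
have FG s : \det (F s) = \det (G s).
  have -> : G s = block_mx 1%:M 0 x 1%:M *m block_mx 1%:M (- s *: one) 0 (F s).
    rewrite mulmx_block !mul1mx !mulmx0 !mul0mx !addr0 mulmx1; congr block_mx.
    apply/matrixP => i j; rewrite !mxE big_ord1 !mxE.
    by rewrite mulr1 mulrN [y i * s]mulrC addrC addrK.
  by rewrite det_mulmx det_lblock det_ublock !det1 !mul1r.
pose G' : 'M[S]_(1 + n) := block_mx 0 (- one) x B.
have affine s : \det (F s) = \det B + s * \det G'.
  rewrite FG (@determinant_multilinear _ _ (G s) (G 0) G' ord0 1 s).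
  - rewrite mul1r -FG; congr (\det _ + _).
    by apply/matrixP => i j; rewrite !mxE mul0r addr0.
  - have e0 : ord0 = lshift n ord0 :> 'I_(1 + n) by apply: val_inj.
    rewrite e0 /G /G' /block_mx -!row_usubmx !col_mxKu scale1r.
    apply/rowP => j; rewrite -[j]fintype.splitK !mxE; case: (fintype.split j) => k /=.
      by rewrite (_ : fintype.split _ = inl k) ?(unsplitK (inl k)) // !mxE mulr0 addr0.
    rewrite (_ : fintype.split _ = inr k) ?(unsplitK (inr k)) // !mxE.
    by rewrite oppr0 mul0r add0r mulNr mulrN.
  - apply/matrixP => i j; rewrite [LHS]mxE [RHS]mxE /G /block_mx.
    by have -> : lift ord0 i = rshift 1 i; [apply: val_inj | rewrite !col_mxEd].
  - apply/matrixP => i j; rewrite [LHS]mxE [RHS]mxE /G /G' /block_mx.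
    by have -> : lift ord0 i = rshift 1 i; [apply: val_inj | rewrite !col_mxEd].
have Fa : \det (F (- a)) = \prod_i (d i - a * y i).
  rewrite det_trig; last first.
    apply/is_trig_mxP => i j ij; rewrite !mxE -val_eqE /= (ltn_eqF ij) ij.
    by rewrite mulNr mulrC subrr.
  by apply: eq_bigr => i _; rewrite !mxE eqxx mulNr.
have Fb : \det (F (- b)) = \prod_i (d i - b * y i).
  rewrite -det_tr det_trig; last first.
    apply/is_trig_mxP => i j ij; rewrite !mxE -val_eqE /= (gtn_eqF ij).
    by rewrite ltnNge (ltnW ij) /= mulNr mulrC subrr.
  by apply: eq_bigr => i _; rewrite !mxE eqxx mulNr.
(* The slope cancels in b det F(-a) - a det F(-b). *)
by rewrite -Fa -Fb !affine; ring.
Qed.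

(** * Polynomials modulo a power of the variable *)

Definition eq_upto (T : nzRingType) (K : nat) (p q : {poly T}) :=
  forall i, (i < K)%N -> p`_i = q`_i.

Section EqUpto.
Variables (T : comNzRingType) (K : nat).
Implicit Types p q r : {poly T}.

(** The explicit remainder turns congruences into equations that ring identities can combine. *)
Lemma eq_uptoP p q : eq_upto K p q <-> exists r, p = q + r * 'X^K.
Proof.
split=> [pq|[r ->] i iK]; last by rewrite coefD coefMXn iK addr0.
exists (drop_poly K p - drop_poly K q).
rewrite -{1}[p](poly_take_drop K) -{1}[q](poly_take_drop K) mulrBl.
suff -> : take_poly K p = take_poly K q by ring.
by apply/polyP => i; rewrite !coef_take_poly; case: ifP => // /pq.
Qed.

Lemma eq_upto_reg (c : T) p q : GRing.lreg c ->
  eq_upto K (c%:P * p) (c%:P * q) -> eq_upto K p q.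
Proof. by move=> c_reg pq i /pq; rewrite !coefCM => /c_reg. Qed.

(** The geometric series in u = 1 - p inverts p up to u^K, and u is divisible by ['X]. *)
Lemma inv_upto p : p`_0 = 1 -> exists q r, p * q = 1 + r * 'X^K.
Proof.
move=> p0; pose u := 1 - p.
have /factor_theorem[s us] : root u 0.
  by rewrite /root horner_coef0 coefB coef1 p0 subrr.
exists (\sum_(i < K) u ^+ i), (- s ^+ K).
have -> : p = - (u - 1) by rewrite /u; ring.
by rewrite mulNr -subrX1 us subr0 exprMn; ring.
Qed.

Lemma eq_upto_cancel (u p q : {poly T}) : u`_0 = 1 ->
  eq_upto K (u * p) (u * q) -> eq_upto K p q.
Proof.
move=> u0 /eq_uptoP[r upq]; have [v [s uv]] := inv_upto u0; apply/eq_uptoP.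
exists (v * r + (q - p) * s).
have : v * (u * p) = v * (u * q + r * 'X^K) by rewrite upq.
rewrite mulrDr ![v * (u * _)]mulrA [v * u]mulrC uv => /eqP.
rewrite -subr_eq0 => /eqP e; apply/eqP; rewrite -subr_eq0 -e; apply/eqP; ring.
Qed.

End EqUpto.

Lemma map_poly_Leibniz (T : comNzRingType) (D : {additive T -> T}) :
  (forall a b, D (a * b) = D a * b + a * D b) ->
  forall p q, map_poly D (p * q) = map_poly D p * q + p * map_poly D q.
Proof.
move=> DM p q; apply/polyP => i.
rewrite coefD !coefM coef_map coefM raddf_sum -big_split /=.
by apply: eq_bigr => j _; rewrite DM !coef_map.
Qed.

Section TraceSeries.
Variables (T : comNzRingType) (D : {additive T -> T}).
Hypothesis DM : forall a b, D (a * b) = D a * b + a * D b.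
Variables (N : nat) (A : 'M[T]_N).

Definition rev_char_poly : {poly T} := \det (1%:M - 'X *: map_mx polyC A).

Definition trace_deriv n : T := \tr (A ^+ n *m map_mx D A).

(** Write z for ['X], M for 1 - zA and q for its determinant. The partial geometric series [S]
    inverts M modulo z^K, so the adjugate of M is q S modulo z^K; Jacobi's formula for D q then
    becomes a trace of S dA. *)
Lemma trace_deriv_series K :
  eq_upto K (rev_char_poly * \sum_(n < K) trace_deriv n *: 'X^(n.+1))
    (- map_poly D rev_char_poly).
Proof.
have D1 := Leibniz1 DM.
pose Ac := map_mx polyC A; pose dA := map_mx polyC (map_mx D A).
pose M : 'M_N := 1%:M - 'X *: Ac.
have dM : map_mx (map_poly D) M = - 'X *: dA.
  apply/matrixP => i j; rewrite !mxE raddfB /= (map_poly_Leibniz DM).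
  rewrite (_ : map_poly D 'X = 0); last first.
    by apply/polyP => k; rewrite coef_map coefX coef0; case: eqP; rewrite ?raddf0.
  rewrite (_ : map_poly D (_ *+ _) = 0); last first.
    by case: (i == j); rewrite ?raddf0 //; apply/polyP => k;
      rewrite coef_map coef1 coef0; case: eqP; rewrite ?raddf0.
  by rewrite map_polyC /=; ring.
have dq : map_poly D rev_char_poly = - 'X * \tr (\adj M *m dA).
  rewrite /rev_char_poly -/Ac -/M (Leibniz_det _ (map_poly_Leibniz DM)) dM.
  by rewrite -scalemxAr mxtraceZ.
pose S : 'M_N := \sum_(n < K) 'X^n *: Ac ^+ n.
have MS : M *m S = 1%:M - 'X^K *: Ac ^+ K.
  have eS n : 'X^n *: Ac ^+ n = ('X *: Ac) ^+ n.
    elim: n => [|n IH]; first by rewrite !expr0 scale1r.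
    by rewrite !exprS -IH -!mulmxE -scalemxAl -scalemxAr scalerA.
  rewrite /S eS (eq_bigr (fun n : 'I_K => ('X *: Ac) ^+ n)) //.
  have := subrX1 ('X *: Ac) K; rewrite -mulmxE => e.
  by rewrite -[RHS]opprB e -mulNmx opprB.
have -> : \sum_(n < K) trace_deriv n *: 'X^(n.+1) = 'X * \tr (S *m dA).
  rewrite mulmx_suml raddf_sum mulr_sumr; apply: eq_bigr => n _ /=.
  rewrite -scalemxAl mxtraceZ mulrA -exprS -mul_polyC mulrC; congr (_ * _).
  by rewrite /trace_deriv -trace_map_mx map_mxM rmorphXn.
have qS : rev_char_poly *: S = \adj M - 'X^K *: (\adj M *m Ac ^+ K).
  rewrite -mul_scalar_mx -mul_adj_mx -mulmxA MS mulmxBr mulmx1.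
  by rewrite -scalemxAr.
have qtr : rev_char_poly * \tr (S *m dA) =
    \tr (\adj M *m dA) - 'X^K * \tr (\adj M *m Ac ^+ K *m dA).
  by rewrite -mxtraceZ scalemxAl qS mulmxBl raddfB /= -scalemxAl mxtraceZ.
apply/eq_uptoP; exists (- 'X * \tr (\adj M *m Ac ^+ K *m dA)).
by rewrite mulrCA qtr dq; ring.
Qed.

End TraceSeries.

(** * Words as closed walks *)

Fixpoint words (N n : nat) : seq (seq nat) :=
  if n is n'.+1 then [seq i :: w | i <- iota 0 N, w <- words N n'] else [:: [::]].

Lemma mem_words N n w :
  (w \in words N n) = (size w == n) && all (fun i => i < N)%N w.
Proof.
elim: n w => [|n IH] [|i w] //=; first by apply/negbTE/allpairsPdep => -[? [? []]].
rewrite eqSS; apply/allpairsPdep/idP => [[j [v [jN vN [-> ->]]]]|].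
  by move: vN jN; rewrite IH mem_iota => /andP[-> ->] /andP[_ ->].
move=> /and3P[sw iN wN]; exists i, w; split=> //; first by rewrite mem_iota.
by rewrite IH sw.
Qed.

Lemma words_uniq N n : uniq (words N n).
Proof.
elim: n => //= n IH; apply: allpairs_uniq => //; first exact: iota_uniq.
by move=> [? ?] [? ?] _ _ [-> ->].
Qed.

(** The trace sums over closed walks. Each step carries [y] of its starting letter, so every letter
    counts once; the closing step from the last letter to the first has weight [b]. *)
Lemma trace_words (T : comNzRingType) N n (y : nat -> T) (a b : nat -> nat -> T) :
  \tr ((\matrix_(i < N, j < N) (y i * a i j)) ^+ n *m
        (\matrix_(i < N, j < N) (y i * b i j))) =
  \sum_(w <- words N n.+1)
    \prod_(p < n) a (nth 0%N w p) (nth 0%N w p.+1) *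
    b (last 0%N w) (head 0%N w) * \prod_(i <- w) y i.
Proof.
set A := \matrix_(i, j) _; set B := \matrix_(i, j) _.
have iota_ord (F : nat -> T) : \sum_(i <- iota 0 N) F i = \sum_(i < N) F i.
  by rewrite -(big_mkord xpredT) /index_iota subn0.
have entry (i j : 'I_N) : (A ^+ n *m B) i j =
    \sum_(w <- words N n)
      \prod_(p < n) a (nth 0%N (nat_of_ord i :: w) p) (nth 0%N (nat_of_ord i :: w) p.+1) *
      b (last (nat_of_ord i) w) j * \prod_(k <- nat_of_ord i :: w) y k.
  elim: n i => [|n IH] i.
    by rewrite expr0 mul1mx big_seq1 big_ord0 big_seq1 mxE mul1r mulrC.
  rewrite exprS -mulmxE -mulmxA mxE /= big_allpairs_dep iota_ord; apply: eq_bigr => k _.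
  rewrite IH mulr_sumr; apply: eq_bigr => w _.
  by rewrite mxE big_ord_recl /= [in RHS]big_cons; ring.
rewrite /mxtrace /= big_allpairs_dep iota_ord.
by apply: eq_bigr => i _; rewrite entry.
Qed.

(** * Symmetric functions of a finite alphabet and the common recursion *)

Section Alphabet.
Variables (R : comNzRingType) (x : nat -> R).
Local Notation t := ('X : {poly R}).

(** The e_k of the first N letters, specified by recursion on N so that truncated series and the
    images of [mesym] are both instances. *)
Definition is_esym (e : nat -> nat -> R) :=
  [/\ forall k, e 0 k = (k == 0)%:R, forall N, e N.+1 0 = e N 0 &
      forall N k, e N.+1 k.+1 = e N k.+1 + x N * e N k].

Definition is_hsym (h : nat -> nat -> R) :=
  [/\ forall k, h 0 k = (k == 0)%:R, forall N, h N.+1 0 = h N 0 &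
      forall N k, h N.+1 k.+1 = h N k.+1 + x N * h N.+1 k].

(** This is E(cz), where z is the outer variable. *)
Definition linprod N (c : {poly R}) : {poly {poly R}} :=
  \prod_(i < N) (1 + (c * (x i)%:P)%:P * 'X).

Lemma coef_linprod e : is_esym e ->
  forall N c k, (linprod N c)`_k = c ^+ k * (e N k)%:P.
Proof.
move=> [e0 eS0 eSS]; elim=> [|N IH] c k.
  rewrite /linprod big_ord0 coef1 e0; case: k => [|k]; rewrite /= ?mulr0 //.
  by rewrite mulr1.
rewrite /linprod big_ord_recr /= mulrDr mulr1 coefD [_%:P * 'X]mulrC mulrA coefMC.
rewrite coefMX -/(linprod N c) IH; case: k => [|k]; rewrite /= ?eS0 ?mul0r ?addr0 //.
by rewrite IH eSS polyCD polyCM exprS; ring.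
Qed.

(** This is E(-cz) H(cz) = 1 modulo z^K. The factor 1 - c x_N z of a new letter turns H for N + 1
    letters into H for N letters. *)
Lemma linprod_hsym h : is_hsym h -> forall K N c,
  eq_upto K (linprod N (- c) * \poly_(k < K) (c ^+ k * (h N k)%:P)) 1.
Proof.
move=> [h0 hS0 hSS] K; elim=> [|N IH] c.
  rewrite /linprod big_ord0 mul1r => k kK; rewrite coef_poly kK h0 coef1.
  by case: k kK => [|k] _ /=; rewrite ?mulr0 ?mulr1.
move: (IH c) => /eq_uptoP[r IHr].
set pN := \poly_(k < K) _ in IHr.
have : eq_upto K ((1 + (- c * (x N)%:P)%:P * 'X) * \poly_(k < K) (c ^+ k * (h N.+1 k)%:P)) pN.
  move=> k kK; rewrite mulrDl mul1r coefD -mulrA coefCM coefXM.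
  rewrite !coef_poly kK; case: k kK => [|k] kK /=; first by rewrite hS0 mulr0 addr0.
  by rewrite (ltnW kK) hSS polyCD polyCM exprS; ring.
move=> /eq_uptoP[s e]; apply/eq_uptoP; exists (r + linprod N (- c) * s).
rewrite /linprod big_ord_recr /= -mulrA e -/(linprod N (- c)) mulrDr IHr; ring.
Qed.

Definition tgeom (k : nat) : {poly R} := \sum_(1 <= j < k) t ^+ j.

Lemma tgeomE k : (1 - t) * - tgeom k.+1 = t ^+ k.+1 - t.
Proof.
rewrite /tgeom big_add1 /= big_mkord.
have -> : \sum_(i < k) t ^+ i.+1 = t * \sum_(i < k) t ^+ i.
  by rewrite mulr_sumr; apply: eq_bigr => i _; rewrite exprS.
have := subrX1 t k; rewrite exprS => e.
have -> : t * t ^+ k - t = t * (t ^+ k - 1) by ring.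
by rewrite e; ring.
Qed.

Lemma lreg_1t : GRing.lreg (1 - t).
Proof. by rewrite -opprB; apply/lregN/monic_lreg/monicXsubC. Qed.

(* [C n] is the sum over words of length [n + 1]. *)
Definition smirnov_recursion (g : nat -> R) (C : nat -> {poly R}) (n : nat) :=
  C n = \sum_(j < n) tgeom j.+1 * (g j.+1)%:P * C (n - j.+1)%N +
        (tgeom n.+1)^`() * (g n.+1)%:P.

(** The recursion is the coefficient of z^(n+1). Since 1 - t is regular, q has constant term 1 and
    its coefficient at z^k, for 0 < k < n + 2, is - [tgeom k] g_k. *)
Lemma series_recursion (g : nat -> R) (C : nat -> {poly R}) n (q : {poly {poly R}}) :
  (forall k, (k < n.+2)%N -> (1 - t) * q`_k = (t ^+ k - t) * (g k)%:P) -> g 0%N = 1 ->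
  eq_upto n.+2 (q * \sum_(i < n.+2) C i *: 'X^(i.+1)) (- map_poly (@deriv R) q) ->
  smirnov_recursion g C n.
Proof.
move=> qE g0 /(_ n.+1 (ltnSn _)).
have q0 : q`_0 = 1 by apply: lreg_1t; rewrite qE // g0 !mulr1.
have qS k : (k < n.+1)%N -> q`_k.+1 = - tgeom k.+1 * (g k.+1)%:P.
  by move=> kn; apply: lreg_1t; rewrite qE // mulrA tgeomE.
have -> : \sum_(i < n.+2) C i *: 'X^(i.+1) = 'X * \poly_(i < n.+2) C i.
  rewrite poly_def mulr_sumr; apply: eq_bigr => i _.
  by rewrite exprS scalerAr.
rewrite coefN coef_map mulrCA coefXM coefM big_ord_recl /= q0 mul1r coef_poly.
rewrite subn0 ltnW // qS //= mulNr derivN opprK derivM derivC mulr0 addr0.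
move=> e; rewrite /smirnov_recursion -e addrC -addrA -big_split /= big1 ?addr0 // => i _.
rewrite /bump /= add1n qS; last by rewrite ltnW // ltnS.
rewrite coef_poly (leq_ltn_trans (leq_subr _ _)) // mulNr; ring.
Qed.

End Alphabet.

(** * Recursions for the strict and the weak word sums *)

Lemma rev_char_poly_two_constants (T : comNzRingType) N (y : nat -> T) (al be de : T)
    (a : nat -> nat -> T) :
  (forall i j, a i j = if (i < j)%N then al else if (j < i)%N then be else de) ->
  (be - al)%:P * rev_char_poly (\matrix_(i < N, j < N) (y i * a i j)) =
    be%:P * \prod_(i < N) (1 + ((al - de) * y i)%:P * 'X)
    - al%:P * \prod_(i < N) (1 + ((be - de) * y i)%:P * 'X).
Proof.
move=> aE; rewrite /rev_char_poly.
(* [d] is the diagonal of 1 - 'X A, and [z i] is the factor common to the entries of row i off the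
   diagonal. *)
pose d (i : 'I_N) := 1 - (de * y i)%:P * 'X; pose z (i : 'I_N) := - 'X * (y i)%:P.
have -> : 1%:M - 'X *: map_mx polyC (\matrix_(i < N, j < N) (y i * a i j)) =
    \matrix_(i, j) (if i == j then d i else
      if (i < j)%N then z i * al%:P else z i * be%:P).
  apply/matrixP => i j; rewrite !mxE aE -val_eqE /= /d /z.
  by case: ltngtP => _; rewrite /= ?mulr0n ?mulr1n !polyCM; ring.
rewrite polyCB det_two_constants; congr (_ * _ - _ * _);
  by apply: eq_bigr => i _; rewrite /d /z !polyCM polyCB; ring.
Qed.

Section Sums.
Variables (R : comNzRingType) (x : nat -> R).
Local Notation t := ('X : {poly R}).
Local Notation linprod := (linprod x).

Definition word_sum N (a b : nat -> nat -> {poly R}) n : {poly R} :=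
  \sum_(w <- words N n.+1)
    \prod_(p < n) a (nth 0%N w p) (nth 0%N w p.+1) *
    b (last 0%N w) (head 0%N w) * \prod_(i <- w) (x i)%:P.

Definition alphabet_mx N (a : nat -> nat -> {poly R}) : 'M_N :=
  \matrix_(i < N, j < N) ((x i)%:P * a i j).

Lemma word_sum_series N a b K : (forall i j, (a i j)^`() = b i j) ->
  eq_upto K
    (rev_char_poly (alphabet_mx N a) * \sum_(n < K) word_sum N a b n *: 'X^(n.+1))
    (- map_poly (@deriv R) (rev_char_poly (alphabet_mx N a))).
Proof.
move=> ab; have := @trace_deriv_series _ _ (@derivM R) _ (alphabet_mx N a) K.
congr (eq_upto K (_ * _) _); apply: eq_bigr => n _; congr (_ *: _).
rewrite /word_sum -trace_words /trace_deriv; congr (\tr (_ *m _)).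
by apply/matrixP => i j; rewrite !mxE /= derivM derivC mul0r add0r ab.
Qed.

Definition strict_weight i j : {poly R} := t *+ (j < i)%N + (i < j)%N%:R.
(** The closing weight is the t-derivative of [strict_weight]; it keeps the words with w_1 < w_n. *)
Definition strict_sum N :=
  word_sum N strict_weight (fun i j => (j < i)%N%:R).

(* The two terms of [weak_weight] are the choices p in D and p not in D; the
   subtracted sum in [weak_sum] is the contribution of D = all positions. *)
Definition weak_weight i j : {poly R} := t *+ (i <= j)%N + (j <= i)%N%:R.
Definition weak_sum N n :=
  word_sum N weak_weight (fun i j => (i <= j)%N%:R) n -
  word_sum N (fun i j => t *+ (i <= j)%N) (fun i j => (i <= j)%N%:R) n.

Lemma deriv_natr n : (n%:R : {poly R})^`() = 0.
Proof. by rewrite -polyC_natr derivC. Qed.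

Lemma esym0 e : is_esym x e -> forall N, e N 0%N = 1.
Proof. by case=> e0 eS _; elim=> [|N IH]; rewrite ?eS ?e0. Qed.

Lemma hsym0 h : is_hsym x h -> forall N, h N 0%N = 1.
Proof. by case=> e0 eS _; elim=> [|N IH]; rewrite ?eS ?e0. Qed.

Lemma strict_sum_recursion e : is_esym x e ->
  forall N n, smirnov_recursion (e N) (strict_sum N) n.
Proof.
move=> he N n; apply: (series_recursion (q := rev_char_poly (alphabet_mx N strict_weight))).
- move=> k _.
  have aE i j : strict_weight i j = if (i < j)%N then 1 else if (j < i)%N then t else 0.
    by rewrite /strict_weight; case: ltngtP => _; rewrite ?mulr0n ?mulr1n ?addr0 ?add0r.
  have := rev_char_poly_two_constants N (fun i => (x i)%:P) aE.
  rewrite !subr0 -!/(linprod _ _) => /(congr1 (coefp k)) /=.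
  rewrite coefB !coefCM !(coef_linprod he) expr1n => e1.
  by rewrite -opprB mulNr e1; ring.
- exact: esym0.
- apply: word_sum_series => i j; rewrite derivD deriv_natr addr0.
  by case: (j < i)%N; rewrite ?mulr0n ?mulr1n ?deriv0 ?derivX.
Qed.

(** Here (1 - t) q = H(tz) - t H(z) and q0 = E(-tz) up to degree K, while (1 - t) qw = E(-z) - t
    E(-tz); hence qw = q E(-z) q0 modulo z^K. As E(-z) is free of t, the logarithmic derivative of q
    is that of qw minus that of q0, and the two sums in [weak_sum] have these as series, up to
    sign. *)
Lemma weak_sum_recursion e h : is_esym x e -> is_hsym x h ->
  forall N n, smirnov_recursion (h N) (weak_sum N) n.
Proof.
move=> he hh N n; have [K KE] : exists K, K = n.+2 by exists n.+2.
pose qw := rev_char_poly (alphabet_mx N weak_weight).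
pose q0 := rev_char_poly (alphabet_mx N (fun i j => t *+ (i <= j)%N)).
pose E1 := linprod N (- 1).
pose ser c := \poly_(k < K) (c ^+ k * (h N k)%:P).
pose q := \poly_(k < K) (if k is k'.+1 then - tgeom R k * (h N k)%:P else 1).
pose D := map_poly (@deriv R).
have DM := map_poly_Leibniz (@derivM R).
have qwE : (1 - t)%:P * qw = E1 - t%:P * linprod N (- t).
  have aE i j : weak_weight i j = if (i < j)%N then t else if (j < i)%N then 1 else 1 + t.
    by rewrite /weak_weight; case: ltngtP => _; rewrite ?mulr0n ?mulr1n ?addr0 ?add0r // addrC.
  have := rev_char_poly_two_constants N (fun i => (x i)%:P) aE.
  have -> : t - (1 + t) = -1 by ring.
  have -> : 1 - (1 + t) = - t by ring.
  by rewrite mul1r.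
have q0E : q0 = linprod N (- t).
  have aE i j : t *+ (i <= j)%N = if (i < j)%N then t else if (j < i)%N then 0 else t.
    by case: ltngtP.
  have := rev_char_poly_two_constants N (fun i => (x i)%:P) aE.
  rewrite !sub0r mul0r sub0r polyCN mulNr => /oppr_inj e0.
  apply/polyP => k; apply: (monic_lreg (monicX R)).
  by have := congr1 (coefp k) e0; rewrite /= !coefCM.
have q_ser : (1 - t)%:P * q = ser t - t%:P * ser 1.
  apply/polyP => k; rewrite coefB !coefCM !coef_poly; case: ltnP => _; last first.
    by rewrite !mulr0 subr0.
  case: k => [|k]; first by rewrite (hsym0 hh) expr0 !mulr1.
  by rewrite mulrA tgeomE expr1n; ring.
have [r1 s1] : exists r, E1 * ser 1 = 1 + r * 'X^K.
  by apply/eq_uptoP/linprod_hsym.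
have [r2 s2] : exists r, linprod N (- t) * ser t = 1 + r * 'X^K.
  by apply/eq_uptoP/linprod_hsym.
have [r qw_q] : exists r, qw = q * E1 * q0 + r * 'X^K.
  apply/eq_uptoP; apply: (eq_upto_reg (lreg_1t (R := R))); apply/eq_uptoP.
  exists (t%:P * q0 * r1 - E1 * r2).
  have -> : (1 - t)%:P * (q * E1 * q0) = (1 - t)%:P * q * E1 * q0 by ring.
  rewrite qwE q_ser q0E.
  have -> : (ser t - t%:P * ser 1) * E1 * linprod N (- t) =
    (linprod N (- t) * ser t) * E1 - t%:P * (E1 * ser 1) * linprod N (- t) by ring.
  by rewrite s1 s2; ring.
have [r3 s3] : exists r, qw * (\sum_(i < K)
    word_sum N weak_weight (fun i j => (i <= j)%N%:R) i *: 'X^(i.+1)) =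
    - D qw + r * 'X^K.
  apply/eq_uptoP/word_sum_series => i j.
  rewrite /weak_weight derivD deriv_natr addr0.
  by case: (i <= j)%N; rewrite ?mulr0n ?mulr1n ?deriv0 ?derivX.
have [r4 s4] : exists r, q0 * (\sum_(i < K)
    word_sum N (fun i j => t *+ (i <= j)%N) (fun i j => (i <= j)%N%:R) i *: 'X^(i.+1)) =
    - D q0 + r * 'X^K.
  apply/eq_uptoP/word_sum_series => i j.
  by case: (i <= j)%N; rewrite ?mulr0n ?mulr1n ?deriv0 ?derivX.
have DE1 : D E1 = 0.
  apply/polyP => k; rewrite coef_map (coef_linprod he) coef0 /=.
  by rewrite -polyCN -polyC_exp -polyCM derivC.
have DXK : D 'X^K = 0.
  apply/polyP => k; rewrite coef_map coefXn coef0 /=; exact: deriv_natr.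
apply: (series_recursion (q := q)).
- move=> k; rewrite -KE => kK; have := congr1 (coefp k) q_ser.
  rewrite /= coefB !coefCM !coef_poly kK expr1n => ->; ring.
- exact: hsym0.
rewrite -KE; have lin0 c : (linprod N c)`_0 = 1 by rewrite (coef_linprod he) (esym0 he) mulr1.
(* Clearing denominators: [E1 * q0] completes [q] to [qw], and the second [q0] belongs to the
   subtracted series. *)
apply: (@eq_upto_cancel _ _ (E1 * q0 * q0)).
  by rewrite !coef0M q0E !lin0 !mulr1.
apply/eq_uptoP.
under eq_bigr do rewrite /weak_sum scalerBl.
rewrite sumrB -/D; set Gw := \sum_(i < K) _ in s3 *; set G0 := \sum_(i < K) _ in s4 *.
clearbody Gw G0 E1 q q0 qw; exists (q0 * (r3 - D r) - r * q0 * Gw - E1 * q0 * q * r4).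
have Dqw : D qw = D q * E1 * q0 + q * E1 * D q0 + D r * 'X^K.
  by rewrite qw_q /D raddfD /= !DM -/D DE1 DXK; ring.
have qE : q * E1 * q0 = qw - r * 'X^K by rewrite qw_q addrK.
have -> : E1 * q0 * q0 * (q * (Gw - G0)) =
  q0 * ((q * E1 * q0) * Gw) - E1 * q0 * q * (q0 * G0) by ring.
by rewrite qE mulrBl s3 s4 Dqw; ring.
Qed.
End Sums.

(** * Coefficients of series and truncation to a finite alphabet *)

Definition mcoef (m : {mset nat}) (f : fps) : int := f m.

Lemma mcoef_is_additive m : zmod_morphism (mcoef m). Proof. by []. Qed.

HB.instance Definition _ m :=
  GRing.isZmodMorphism.Build fps int (mcoef m) (mcoef_is_additive m).

Lemma mul_xvarE i (f : fps) m :
  (xvar i * f) m = if i \in m then f (m `\ i)%mset else 0.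
Proof.
rewrite [LHS]fps_mulE; case: ifP => im; last first.
  rewrite big1_seq // => a /andP[_]; rewrite mem_msubs => /msubsetP am.
  rewrite /xvar; case: eqP => [ai|_]; last by rewrite mul0r.
  by have := am i; rewrite ai msetnxx -[X in (X <= _)%N]/1%N mset_gt0 im.
have i_sub : [mset i]%mset \in msubs m.
  rewrite mem_msubs; apply/msubsetP => j; rewrite msetnE; case: eqP => // ->.
  by rewrite mset_gt0.
rewrite (bigD1_seq [mset i]%mset) ?msubs_uniq //=.
by rewrite /xvar eqxx mul1r big1 ?addr0 // => a /negPf->; rewrite mul0r.
Qed.

Lemma perm_msetB1 i (m : {mset nat}) : i \in m -> perm_eq m (i :: (m `\ i)%mset).
Proof.
move=> im; apply/allP => j _ /=; rewrite !count_mem_mset msetB1E [i == j]eq_sym.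
by case: (eqVneq j i) => [->|_] /=; rewrite ?subn0 // add1n subn1 prednK // mset_gt0.
Qed.

Lemma seq_mset_nil : seq_mset [::] = mset0 :> {mset nat}.
Proof. by apply/eqP/mset_eqP => j; rewrite mset_seqE mset0E. Qed.

Lemma all_lt0 (m : {mset nat}) : all (fun i => i < 0)%N m -> m = mset0.
Proof.
move=> am; rewrite -[m]seq_mset_id -seq_mset_nil; congr seq_mset.
by case: (enum_mset m) am.
Qed.

Lemma xwE w m : xw w m = (m == seq_mset w)%:R.
Proof.
rewrite /xw; elim: w m => [|i w IH] m.
  by rewrite big_nil -[LHS]/((m == mset0)%:R) seq_mset_nil.
rewrite big_cons mul_xvarE; case: ifP => im.
  rewrite IH; congr (nat_of_bool _)%:R.
  apply/idP/idP => [/eqP e|/eqP ->]; apply/mset_eqP => j.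
    have := perm_msetB1 im => /seq.permP /(_ (pred1 j)).
    by rewrite count_mem_mset /= !mset_seqE count_mem_mset e mset_seqE /= => ->.
  by rewrite msetB1E !mset_seqE /= [i == j]eq_sym addKn.
case: eqP => // e; have : i \in seq_mset (i :: w).
  by rewrite in_mset mset_seqE /= eqxx.
by rewrite -e im.
Qed.

Lemma fps_sumE I (r : seq I) (P : pred I) (F : I -> fps) m :
  (\sum_(i <- r | P i) F i) m = \sum_(i <- r | P i) F i m.
Proof. exact: (raddf_sum (mcoef m)). Qed.

(** Setting x_i = 0 for i >= N, a ring morphism; it reduces the claims to a finite alphabet, where
    matrices are available. *)
Definition trunc (N : nat) (f : fps) : fps :=
  fun m => if all (fun i => i < N)%N m then f m else 0.

Lemma trunc_is_additive N : zmod_morphism (trunc N).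
Proof.
move=> f g; apply/funext => m; rewrite /trunc -[RHS]/(_ + - _) /=.
by case: ifP => // _; rewrite subr0.
Qed.

Lemma trunc_is_monoid N : monoid_morphism (trunc N).
Proof.
split=> [|f g]; apply/funext => m; rewrite /trunc.
  rewrite -[(1 : fps) m]/((m == mset0)%:R); case: ifP => // nm.
  by case: eqP nm => // ->; rewrite enum_mset0.
rewrite -[(f * g) m]/(fps_mul f g m) -[RHS]/(fps_mul _ _ m) !fps_mulE.
case: ifP => am.
  rewrite big_seq [RHS]big_seq; apply: eq_bigr => a; rewrite mem_msubs => sam.
  have ok (b : {mset nat}) : (b `<=` m)%mset -> all (fun i => (i < N)%N) b.
    move=> bm; apply/allP => i ib; apply: (allP am).
    exact: (msubset_subset bm).
  by rewrite !ok ?msetB_sub.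
rewrite big1_seq // => a /andP[_]; rewrite mem_msubs => sam.
case: ifP => aa; last by rewrite mul0r.
case: ifP => ab; last by rewrite mulr0.
case/negP: am; apply/allP => i; rewrite -(msetBDKC sam) in_msetD.
by case/orP => [/(allP aa)|/(allP ab)].
Qed.

HB.instance Definition _ N :=
  GRing.isZmodMorphism.Build fps fps (trunc N) (trunc_is_additive N).
HB.instance Definition _ N :=
  GRing.isMonoidMorphism.Build fps fps (trunc N) (trunc_is_monoid N).

(** A monomial involves finitely many letters, so some truncation keeps its coefficient. *)
Lemma trunc_inj (f g : fps) : (forall N, trunc N f = trunc N g) -> f = g.
Proof.
move=> fg; apply/funext => m.
pose N := (\max_(i <- (m : seq nat)) i).+1.
have mN : all (fun i => i < N)%N m.
  by apply/allP => i im; rewrite ltnS; apply: leq_bigmax_seq.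
by have := congr1 (mcoef m) (fg N); rewrite /mcoef /trunc mN.
Qed.

Lemma trunc_xsum N n (A : set (seq nat)) : (forall w, A w -> size w = n) ->
  trunc N (xsum A) = \sum_(w <- words N n | `[< A w >]) xw w.
Proof.
move=> An; apply/funext => m; rewrite fps_sumE /trunc.
have all_w w : m = seq_mset w -> all (fun i => (i < N)%N) m = all (fun i => (i < N)%N) w.
  by move=> ->; apply/perm_all/perm_eq_seq_mset.
case: ifP => am; last first.
  rewrite big1_seq // => w /andP[_]; rewrite mem_words xwE => /andP[_ aw].
  by case: eqP => // /all_w; rewrite am aw.
rewrite /xsum (fsbigE [seq w <- words N n | `[< A w >]]).
- by rewrite big_filter_cond; apply: eq_bigl => w; rewrite andb_idr // => /asboolP /mem_set.
- by rewrite filter_uniq ?words_uniq.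
- by move=> w /=; rewrite mem_filter => /andP[/asboolP].
- move=> w Aw; rewrite mem_filter mem_words An // eqxx asboolT //= => naw.
  by rewrite xwE; case: eqP => // /all_w; rewrite am (negPf naw).
Qed.

(** The only candidate word is the sorted list of m, strictly increasing exactly when m has no
    repetition. *)
Lemma esfE k m : esf k m = ((size m == k) && uniq m)%:R.
Proof.
rewrite /esf /xsum.
have w_sort w : sorted ltn w -> m = seq_mset w -> w = sort leq m.
  move=> sw ->; apply: (sorted_eq leq_trans anti_leq).
  - by move: sw; rewrite ltn_sorted_uniq_leq => /andP[].
  - exact: sort_sorted leq_total _.
  - by rewrite perm_sym perm_sort perm_eq_seq_mset.
case: (boolP ((size m == k) && uniq m)) => [/andP[/eqP sm um]|nm]; last first.
  rewrite fsbig1 // => w [sw lw]; rewrite xwE; case: eqP => // e; move: nm.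
  have pw : perm_eq m w by rewrite e perm_eq_seq_mset.
  rewrite (perm_size pw) sw eqxx (perm_uniq pw).
  by move: lw; rewrite ltn_sorted_uniq_leq => /andP[->].
have sort_in : size (sort leq m) = k /\ sorted ltn (sort leq m).
  by rewrite size_sort ltn_sorted_uniq_leq sort_uniq um sort_sorted //; exact: leq_total.
rewrite (fsbigE [:: sort leq m]) //=.
- rewrite big_mkcond big_seq1 mem_set // xwE; case: eqP => // -[]; apply/esym.
  by rewrite -{2}[m]seq_mset_id; apply/eq_seq_msetP; rewrite perm_sort.
- by move=> w /=; rewrite inE => /eqP ->.
- move=> w [_ /w_sort h]; rewrite inE xwE => nw.
  by case: eqP => // /h e; rewrite e eqxx in nw.
Qed.

Lemma hsfE k m : hsf k m = (size m == k)%:R.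
Proof.
rewrite /hsf /xsum.
have w_sort w : sorted leq w -> m = seq_mset w -> w = sort leq m.
  move=> sw ->; apply: (sorted_eq leq_trans anti_leq) => //.
  - exact: sort_sorted leq_total _.
  - by rewrite perm_sym perm_sort perm_eq_seq_mset.
case: (boolP (size m == k)) => [/eqP sm|nm]; last first.
  rewrite fsbig1 // => w [sw lw]; rewrite xwE; case: eqP => // e; move: nm.
  have pw : perm_eq m w by rewrite e perm_eq_seq_mset.
  by rewrite (perm_size pw) sw eqxx.
have sort_in : size (sort leq m) = k /\ sorted leq (sort leq m).
  by rewrite size_sort sort_sorted //; exact: leq_total.
rewrite (fsbigE [:: sort leq m]) //=.
- rewrite big_mkcond big_seq1 mem_set // xwE; case: eqP => // -[]; apply/esym.
  by rewrite -{2}[m]seq_mset_id; apply/eq_seq_msetP; rewrite perm_sort.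
- by move=> w /=; rewrite inE => /eqP ->.
- move=> w [_ /w_sort h]; rewrite inE xwE => nw.
  by case: eqP => // /h e; rewrite e eqxx in nw.
Qed.

Lemma all_ltnS N (s : seq nat) :
  all (fun i => i < N.+1)%N s && (N \notin s) = all (fun i => i < N)%N s.
Proof.
elim: s => //= i s IH; rewrite inE negb_or -IH ltnS [(i < N)%N]ltn_neqAle eq_sym.
by case: (_ != _); case: (_ <= _)%N; rewrite ?andbF ?andbT //=.
Qed.

(** Coefficients are compared according to whether the monomial contains x_N; if it does, one factor
    x_N is removed. *)
Lemma is_esym_esf : is_esym xvar (fun N k => trunc N (esf k)).
Proof.
split=> [k|N|N k]; apply/funext => m.
- have -> : ((k == 0)%:R : fps) m = ((m == mset0) && (k == 0))%:R.
    by case: (k == 0); rewrite ?andbF ?andbT.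
  rewrite /trunc; case: eqP => [->|m0].
    by rewrite enum_mset0 /= esfE enum_mset0 eq_sym andbT.
  by case: ifP => // /all_lt0.
- rewrite /trunc !esfE.
  by case: (_ =P 0) => [/size0nil->|] //=; case: ifP; case: ifP.
- rewrite [RHS]fps_addE mul_xvarE /trunc !esfE; case: (boolP (N \in m)) => Nm; last first.
    by rewrite addr0 -(all_ltnS N m) Nm andbT.
  rewrite -(all_ltnS N m) Nm andbF add0r.
  have pm := perm_msetB1 Nm; rewrite (perm_all _ pm) (perm_size pm) (perm_uniq pm).
  by rewrite /= ltnSn eqSS -(all_ltnS N); case: (all _ _); case: (_ \in _); rewrite ?andbF.
Qed.

Lemma is_hsym_hsf : is_hsym xvar (fun N k => trunc N (hsf k)).
Proof.
split=> [k|N|N k]; apply/funext => m.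
- have -> : ((k == 0)%:R : fps) m = ((m == mset0) && (k == 0))%:R.
    by case: (k == 0); rewrite ?andbF ?andbT.
  rewrite /trunc; case: eqP => [->|m0].
    by rewrite enum_mset0 /= hsfE enum_mset0 eq_sym.
  by case: ifP => // /all_lt0.
- rewrite /trunc !hsfE.
  by case: (_ =P 0) => [/size0nil->|] //=; case: ifP; case: ifP.
- rewrite [RHS]fps_addE mul_xvarE /trunc !hsfE; case: (boolP (N \in m)) => Nm; last first.
    by rewrite addr0 -(all_ltnS N m) Nm andbT.
  rewrite -(all_ltnS N m) Nm andbF add0r.
  have pm := perm_msetB1 Nm; rewrite (perm_all _ pm) (perm_size pm).
  by rewrite /= ltnSn eqSS.
Qed.

(** * The involution omega *)

Lemma rmorph_mmap n (A : nzRingType) (S S' : comNzRingType) (phi : {rmorphism S -> S'})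
    (f : A -> S) (f' : A -> S') (h : 'I_n -> S) (h' : 'I_n -> S') p :
  (forall c, phi (f c) = f' c) -> (forall i, phi (h i) = h' i) ->
  phi (mmap f h p) = mmap f' h' p.
Proof.
move=> ff hh; rewrite /mmap rmorph_sum; apply: eq_bigr => m _.
rewrite rmorphM /= ff /mmap1 rmorph_prod; congr (_ * _).
by apply: eq_bigr => i _; rewrite rmorphXn /= hh.
Qed.

Lemma mmap_mmap n k (S : comNzRingType) (h : 'I_n -> {mpoly int[k]}) (v : 'I_k -> S) p :
  mmap intr v (mmap (@mpolyC k int) h p) = mmap intr (fun i => mmap intr v (h i)) p.
Proof.
pose phi : {rmorphism {mpoly int[k]} -> S} := GRing.RMorphism.clone _ _ (mmap intr v) _.
by apply: (rmorph_mmap (phi := phi)) => // c; rewrite /phi /= mmapC.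
Qed.

Definition mset_of_mnm k (m : 'X_{1..k}) : {mset nat} :=
  seq_mset (flatten [seq nseq (m i) (i : nat) | i <- enum 'I_k]).

Lemma mset_of_mnm_inj k : injective (@mset_of_mnm k).
Proof.
have E (m : 'X_{1..k}) (j : 'I_k) : mset_of_mnm m j = m j.
  rewrite /mset_of_mnm mset_seqE count_flatten -map_comp sumnE big_map big_enum /=.
  rewrite (bigD1 j) //= count_nseq /= eqxx mul1n big1 ?addn0 // => i ij.
  by rewrite count_nseq /= (inj_eq val_inj) (negPf ij).
by move=> m1 m2 e; apply/mnmP => i; rewrite -!E e.
Qed.

Lemma mmap1_xvar k (m : 'X_{1..k}) :
  mmap1 (fun i : 'I_k => xvar i) m = xw (flatten [seq nseq (m i) (i : nat) | i <- enum 'I_k]).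
Proof.
rewrite /mmap1 /xw big_flatten big_map big_enum; apply: eq_bigr => i _ /=.
by rewrite big_nseq -Monoid.iteropE.
Qed.

Definition fps_of_mpoly k : {mpoly int[k]} -> fps :=
  mmap intr (fun i : 'I_k => xvar i).

HB.instance Definition _ k := GRing.RMorphism.copy (@fps_of_mpoly k)
  (mmap intr (fun i : 'I_k => xvar i)).

Lemma fps_of_mpoly_inj k : injective (@fps_of_mpoly k).
Proof.
have E p (m : 'X_{1..k}) : fps_of_mpoly p (mset_of_mnm m) = p@_m.
  rewrite /fps_of_mpoly /mmap fps_sumE.
  transitivity (\sum_(i <- msupp p) p@_i * (m == i)%:R).
    apply: eq_bigr => i _; rewrite mmap1_xvar mulrzl.
    rewrite -[LHS]/(mcoef _ _) raddfMz /= /mcoef xwE -mulrzl intz.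
    by rewrite -/(mset_of_mnm i) (inj_eq (@mset_of_mnm_inj k)).
  case: (boolP (m \in msupp p)) => [mp|/memN_msupp_eq0 pm].
    rewrite (bigD1_seq m) ?msupp_uniq //= eqxx mulr1 big1 ?addr0 // => i im.
    by rewrite eq_sym (negPf im) mulr0.
  rewrite pm big1 // => i _; case: eqP => [<-|]; by rewrite ?pm ?mul0r ?mulr0.
by move=> p q e; apply/mpolyP => m; rewrite -!E e.
Qed.

Lemma is_esym_unique (R : comNzRingType) (x : nat -> R) e e' :
  is_esym x e -> is_esym x e' -> forall N k, e N k = e' N k.
Proof.
move=> [e0 eS0 eSS] [e0' eS0' eSS']; elim=> [|N IH] k; first by rewrite e0 e0'.
by case: k => [|k]; rewrite ?eS0 ?eS0' ?eSS ?eSS' !IH.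
Qed.

(** Both sides satisfy [is_esym], whose solution is unique. *)
Lemma fps_of_mesym N k : fps_of_mpoly (mesym N int k) = trunc N (esf k).
Proof.
apply: (is_esym_unique (e := fun N k => fps_of_mpoly (mesym N int k)) _ is_esym_esf).
split=> [j|M|M j].
- case: j => [|j]; first by rewrite mesym0E rmorph1.
  by rewrite mesym_geqnE // rmorph0.
- by rewrite !mesym0E !rmorph1.
- have wid p : fps_of_mpoly (mwiden p) = fps_of_mpoly p :> fps.
    rewrite /fps_of_mpoly /mwiden mmap_mmap; congr mmap; apply/funext => i.
    by rewrite mmapX mmap1U.
  by rewrite mesymSS rmorphD rmorphM /= !wid {3}/fps_of_mpoly mmapX mmap1U mulrC.
Qed.

Definition esf_poly k (P : {mpoly int[k]}) : fps := mmap intr (fun i : 'I_k => esf i.+1) P.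
Definition hsf_poly k (P : {mpoly int[k]}) : fps := mmap intr (fun i : 'I_k => hsf i.+1) P.

(** Algebraic independence of e_1, ..., e_k: truncated to k letters they are the elementary
    symmetric polynomials, and the fundamental theorem gives uniqueness. *)
Lemma esf_poly_inj k : injective (@esf_poly k).
Proof.
move=> P Q /(congr1 (trunc k)) e.
have E S : trunc k (esf_poly S) =
    fps_of_mpoly (S \mPo [tuple mesym k int i.+1 | i < k]).
  transitivity (mmap intr (fun i : 'I_k => trunc k (esf i.+1)) S).
    by apply: rmorph_mmap => // c; rewrite rmorph_int.
  rewrite /fps_of_mpoly /comp_mpoly mmap_mmap; congr mmap; apply/funext => i.
  by rewrite tnth_mktuple -fps_of_mesym.
by move: e; rewrite !E => /fps_of_mpoly_inj /msym_fundamental_un.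
Qed.

(** The graph of omega on Z[e_1, ..., e_k]; its closure under sums and products does not involve the
    choice made in [omega]. *)
Definition omega_pair k (f g : fps) :=
  exists P : {mpoly int[k]}, f = esf_poly P /\ g = hsf_poly P.

(** Representations in k and in l generators are both viewed in k + l generators, where algebraic
    independence identifies them. *)
Lemma omega_pairE k f g : omega_pair k f g -> omega f = g.
Proof.
move=> [P [fP gP]]; rewrite /omega; case: xgetP => [g' _ [l [Q [fQ gQ]]]|/(_ g)]; last first.
  by case; exists k, P.
have wid a b (ab : (a <= b)%N) (S : {mpoly int[a]}) (v : nat -> fps) :
    mmap intr (fun i : 'I_b => v i.+1)
      (mmap (@mpolyC b int) (fun i : 'I_a => 'X_(widen_ord ab i)) S) =
    mmap intr (fun i : 'I_a => v i.+1) S.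
  by rewrite mmap_mmap; congr mmap; apply/funext => i; rewrite mmapX mmap1U.
have ke : (k <= k + l)%N := leq_addr l k; have le : (l <= k + l)%N := leq_addl k l.
rewrite gQ gP /hsf_poly -(wid _ _ ke) -(wid _ _ le); congr mmap.
by apply: esf_poly_inj; rewrite /esf_poly !wid -fQ fP.
Qed.

Section OmegaPair.
Variable k : nat.

Lemma omega_pairD f f' g g' :
  omega_pair k f g -> omega_pair k f' g' -> omega_pair k (f + f') (g + g').
Proof.
move=> [P [-> ->]] [Q [-> ->]]; exists (P + Q).
by rewrite /esf_poly /hsf_poly !rmorphD.
Qed.

Lemma omega_pairM f f' g g' :
  omega_pair k f g -> omega_pair k f' g' -> omega_pair k (f * f') (g * g').
Proof.
move=> [P [-> ->]] [Q [-> ->]]; exists (P * Q).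
by rewrite /esf_poly /hsf_poly !rmorphM.
Qed.

Lemma omega_pair_nat n : omega_pair k n%:R n%:R.
Proof. by exists n%:R; rewrite /esf_poly /hsf_poly !rmorph_nat. Qed.

Lemma omega_pair_sf j : (j < k)%N -> omega_pair k (esf j.+1) (hsf j.+1).
Proof.
by move=> jk; exists 'X_(Ordinal jk); rewrite /esf_poly /hsf_poly !mmapX !mmap1U.
Qed.

Lemma omega_pair_sum I (r : seq I) (F G : I -> fps) :
  (forall i, omega_pair k (F i) (G i)) ->
  omega_pair k (\sum_(i <- r) F i) (\sum_(i <- r) G i).
Proof.
move=> FG; elim/big_rec2: _ => [|i f g _ fg]; first exact: (omega_pair_nat 0).
exact: omega_pairD.
Qed.

Definition omega_pair_poly (p q : {poly fps}) := forall d, omega_pair k p`_d q`_d.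

Lemma omega_pair_polyD p p' q q' : omega_pair_poly p q -> omega_pair_poly p' q' ->
  omega_pair_poly (p + p') (q + q').
Proof. by move=> h h' d; rewrite !coefD; apply: omega_pairD. Qed.

Lemma omega_pair_polyM p p' q q' : omega_pair_poly p q -> omega_pair_poly p' q' ->
  omega_pair_poly (p * p') (q * q').
Proof.
by move=> h h' d; rewrite !coefM; apply: omega_pair_sum => i; apply: omega_pairM.
Qed.

Lemma omega_pair_poly_sum n (F G : 'I_n -> {poly fps}) :
  (forall i, omega_pair_poly (F i) (G i)) ->
  omega_pair_poly (\sum_i F i) (\sum_i G i).
Proof. by move=> FG d; rewrite !coef_sum; apply: omega_pair_sum => i; apply: FG. Qed.

Lemma omega_pair_polyC f g : omega_pair k f g -> omega_pair_poly f%:P g%:P.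
Proof.
by move=> fg d; rewrite !coefC; case: eqP => // _; apply: (omega_pair_nat 0).
Qed.

(** Strong induction: the recursion involves only sums, products, integers and the e_j with 1 <= j
    <= n <= k. *)
Lemma omega_pair_recursion n C C' : (n <= k)%N ->
  (forall i, (i < n)%N -> smirnov_recursion esf C i) ->
  (forall i, (i < n)%N -> smirnov_recursion hsf C' i) ->
  forall i, (i < n)%N -> omega_pair_poly (C i) (C' i).
Proof.
move=> nk hC hC' i; elim/ltn_ind: i => i IH lin; rewrite hC // hC' //.
have geom j d : omega_pair k (tgeom fps j)`_d (tgeom fps j)`_d.
  rewrite /tgeom coef_sum; apply: omega_pair_sum => l; rewrite coefXn.
  exact: omega_pair_nat.
apply: omega_pair_polyD.
  apply: omega_pair_poly_sum => j; apply: omega_pair_polyM.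
    apply: omega_pair_polyM => //; apply/omega_pair_polyC/omega_pair_sf.
    by have := ltn_ord j; lia.
  by apply: IH; have := ltn_ord j; lia.
apply: omega_pair_polyM; last by apply/omega_pair_polyC/omega_pair_sf; lia.
move=> d; rewrite coef_deriv -mulr_natr.
by apply: omega_pairM => //; apply: omega_pair_nat.
Qed.

End OmegaPair.

(** * Both sides as word sums *)

Lemma desE w : des w = (\sum_(p < (size w).-1) (nth 0%N w p.+1 < nth 0%N w p)%N)%N.
Proof.
by rewrite /des -sum1dep_card big_mkcond; apply: eq_bigr => p _; case: (_ < _)%N.
Qed.

Lemma des_le w : (des w <= (size w).-1)%N.
Proof. by rewrite /des -[X in (_ <= X)%N]card_ord max_card. Qed.

Lemma xw_polyC w : \prod_(i <- w) (xvar i)%:P = (xw w)%:P :> {poly fps}.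
Proof. by rewrite /xw rmorph_prod. Qed.

Lemma prod_strict_weight n w : smirnov n.+1 w ->
  \prod_(p < n) strict_weight fps (nth 0%N w p) (nth 0%N w p.+1) = 'X^(des w).
Proof.
move=> [sw ww]; rewrite desE sw expr_sum; apply: eq_bigr => p _.
by rewrite /strict_weight; have := ww p; case: ltngtP => // _ _;
  rewrite ?mulr0n ?mulr1n ?addr0 ?add0r.
Qed.

(** [strict_weight] vanishes on equal letters, so words that are not Smirnov drop out; the degree
    bound in [Wlt] loses nothing by [des_le]. *)
Lemma trunc_Wlt N n : map_poly (trunc N) (Wlt n.+1) = strict_sum xvar N n.
Proof.
apply/polyP => d; rewrite coef_map /= coef_poly /strict_sum /word_sum coef_sum.
transitivity (\sum_(w <- words N n.+1 | `[< smirnov n.+1 w /\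
    (head 0%N w < last 0%N w)%N /\ des w = d >]) xw w).
  case: ltnP => dn; first by apply: trunc_xsum => w [[]].
  rewrite raddf0 big1 // => w /asboolP[[sw _] [_ dw]].
  by have := des_le w; rewrite sw dw /= leqNgt dn.
rewrite big_mkcond big_seq [RHS]big_seq; apply: eq_bigr => w.
rewrite mem_words => /andP[/eqP sw _]; rewrite xw_polyC coefMC.
case: (pselect (smirnov n.+1 w)) => smw; last first.
  rewrite asboolF; last by case.
  suff [p wp] : exists p : 'I_n, nth 0%N w p = nth 0%N w p.+1.
    by rewrite (bigD1 p) //= /strict_weight wp ltnn mulr0n addr0 !mul0r coef0 mul0r.
  apply: contrapT => nex; apply: smw; split=> // p; apply/eqP => wp.
  by apply: nex; exists p.
rewrite prod_strict_weight //; case: (ltnP (head _ _)) => hl; last first.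
  by rewrite mulr0 coef0 mul0r asboolF //; case=> _ [].
rewrite mulr1 coefXn; case: (eqVneq d) => [->|dd]; first by rewrite asboolT ?mul1r.
by rewrite mul0r asboolF // => -[_ [_ e]]; rewrite e eqxx in dd.
Qed.

Section PermuteWords.
Variable n : nat.
Implicit Types (s : 'S_n) (w : seq nat).

Definition permute_word s w := [seq nth 0%N w (s i) | i <- enum 'I_n].

Lemma nth_permute_word s w (i : 'I_n) : nth 0%N (permute_word s w) i = nth 0%N w (s i).
Proof. by rewrite (nth_map i) ?size_enum_ord // nth_ord_enum. Qed.

Lemma size_permute_word s w : size (permute_word s w) = n.
Proof. by rewrite size_map size_enum_ord. Qed.

Lemma permute_wordK s w : size w = n -> permute_word s^-1 (permute_word s w) = w.
Proof.
move=> sw; apply: (@eq_from_nth _ 0%N); rewrite size_permute_word ?sw // => i ni.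
by rewrite -[i]/(nat_of_ord (Ordinal ni)) !nth_permute_word permKV.
Qed.

Lemma permute_word_in s N w : w \in words N n -> permute_word s w \in words N n.
Proof.
rewrite !mem_words size_permute_word eqxx /= => /andP[/eqP sw /all_nthP aw].
by apply/allP => _ /mapP[i _ ->]; apply: aw; rewrite sw.
Qed.

Lemma xw_permute_word s w : size w = n -> xw (permute_word s w) = xw w.
Proof.
move=> sw; rewrite /xw big_map big_enum /= (big_nth 0%N) sw big_mkord.
by rewrite [RHS](reindex_inj (@perm_inj _ s)).
Qed.

(** [permute_word s] permutes the words of length n, and x_w ignores the order of letters. *)
Lemma sum_permute_word s N (P : pred (seq nat)) :
  \sum_(w <- words N n | P w) xw w = \sum_(w <- words N n | P (permute_word s w)) xw w.
Proof.
have pm : perm_eq (words N n) (map (permute_word s) (words N n)).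
  apply: uniq_perm; first exact: words_uniq.
    rewrite map_inj_in_uniq ?words_uniq // => v w.
    rewrite !mem_words => /andP[/eqP sv _] /andP[/eqP sw _] e.
    by rewrite -(permute_wordK s sv) e permute_wordK.
  move=> w; apply/idP/mapP => [ww|[v vw ->]]; last exact: permute_word_in.
  exists (permute_word s^-1 w); first exact: permute_word_in.
  rewrite -{1}[s]invgK permute_wordK //.
  by move: ww; rewrite mem_words => /andP[/eqP].
rewrite (perm_big _ pm) big_map big_seq_cond [RHS]big_seq_cond.
apply: eq_bigr => w /andP[]; rewrite mem_words => /andP[/eqP sw _] _.
exact: xw_permute_word.
Qed.

End PermuteWords.

Section Permutations.
Variable m : nat.
Implicit Types s : 'S_m.+1.

Lemma nth_pword s (i : 'I_m.+1) : nth 0%N (pword s) i = s i.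
Proof. by rewrite (nth_map ord0) ?size_enum_ord // nth_ord_enum. Qed.

Lemma size_pword s : size (pword s) = m.+1.
Proof. by rewrite size_map size_enum_ord. Qed.

Lemma head_pword s : head 0%N (pword s) = s ord0.
Proof. by rewrite -nth0 -(nth_pword s ord0). Qed.

Lemma last_pword s : last 0%N (pword s) = s ord_max.
Proof. by rewrite -nth_last size_pword -(nth_pword s ord_max). Qed.

Lemma nth_pwordS s (i : 'I_m) : nth 0%N (pword s) i.+1 = s (lift ord0 i).
Proof. by rewrite -nth_pword. Qed.

Lemma nth_pword_widen s (i : 'I_m) :
  nth 0%N (pword s) i = s (widen_ord (leqnSn m) i).
Proof. by rewrite -nth_pword. Qed.

Lemma des_pword s : des (pword s) = #|Des s|.
Proof.
rewrite desE size_pword /= /Des -sum1dep_card [RHS]big_mkcond; apply: eq_bigr => p _.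
by rewrite nth_pwordS nth_pword_widen; case: (_ < _)%N.
Qed.

Definition des_sum_lt : {poly fps} :=
  \sum_(s : 'S_m.+1 | (head 0%N (pword s) < last 0%N (pword s))%N)
      Fqsym (DESge2 (s^-1)%g) *: 'X^(des (pword s)).

(** Reindexing by w = f o s^-1. Taking the inverse of sigma for s makes w the word c = f o sigma. *)
Lemma trunc_Fqsym N (S : {set 'I_m}) s :
  trunc N (@Fqsym m.+1 S) = \sum_(w <- words N m.+1 |
    [forall i : 'I_m, let p := s (widen_ord (leqnSn m) i) in let q := s (lift ord0 i) in
      (nth 0 w q <= nth 0 w p)%N && ((i \in S) ==> (nth 0 w q < nth 0 w p)%N)]) xw w.
Proof.
rewrite /Fqsym (@trunc_xsum N m.+1); last by move=> w [].
rewrite (sum_permute_word s); apply: eq_bigl => w.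
apply/asboolP/forallP => [[_ h] i|h].
  have := h i; rewrite -(nth_permute_word _ _ (lift ord0 i)).
  rewrite -(nth_permute_word _ _ (widen_ord (leqnSn m) i)) lift0 /= => -[-> /implyP].
  by [].
split=> [|i]; first exact: size_permute_word.
have := h i; rewrite -(nth_permute_word _ _ (lift ord0 i)).
by rewrite -(nth_permute_word _ _ (widen_ord (leqnSn m) i)) lift0 /= => /andP[-> /implyP].
Qed.

(** Expanding the product chooses one term of [weak_weight] at each position; D collects the choices
    of the term with t, and the subtracted product is the case D = everything. *)
Lemma weak_weight_compat w : size w = m.+1 ->
  (\prod_(p < m) weak_weight fps (nth 0%N w p) (nth 0%N w p.+1) -
   \prod_(p < m) ('X *+ (nth 0%N w p <= nth 0%N w p.+1)%N)) *
  (last 0%N w <= head 0%N w)%N%:R =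
  \sum_(D | @compat m (nth 0%N w) D) 'X^#|D| :> {poly fps}.
Proof.
move=> sw; rewrite /weak_weight bigA_distr (bigD1 [set: 'I_m]) //=.
rewrite [X in X + _ - _](eq_bigr (fun p : 'I_m => 'X *+ (nth 0%N w p <= nth 0%N w p.+1)%N));
  last by move=> p _; rewrite inE.
rewrite addrAC subrr add0r mulr_suml big_mkcond [RHS]big_mkcond.
apply: eq_bigr => D _; rewrite /compat -nth_last -nth0 sw /=.
case: eqP => //= _; case: (_ <= _)%N; rewrite ?mulr0 ?mulr1 //=.
case: ifP => [/forallP h|/negbT].
  rewrite -sum1_card expr_sum [RHS]big_mkcond; apply: eq_bigr => p _.
  by have := h p; case: (p \in D) => ->; rewrite ?mulr1n.
rewrite negb_forall => /existsP[p np]; rewrite (bigD1 p) //=.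
by move: np; case: (p \in D) => /negPf->; rewrite ?mulr0n mul0r.
Qed.

(** After exchanging sums, a fixed word w receives the permutations good for c = w, and these
    correspond to the compatible sets D. *)
Lemma trunc_des_sum_lt N : map_poly (trunc N) des_sum_lt = weak_sum xvar N m.
Proof.
rewrite /des_sum_lt rmorph_sum /=.
transitivity (\sum_(w <- words N m.+1)
    \sum_(s | @good_perm m (nth 0%N w) s) 'X^#|Des s| * (xw w)%:P : {poly fps}).
  under [RHS]eq_bigr do rewrite big_mkcond.
  rewrite exchange_big [LHS]big_mkcond; apply: eq_bigr => s _ /=; rewrite -big_mkcond.
  rewrite head_pword last_pword; case: ifP => sl; last first.
    by rewrite big1 // => w; rewrite /good_perm sl.
  rewrite map_polyZ map_polyXn /= (trunc_Fqsym _ _ (s^-1)%g) des_pword scaler_suml.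
  apply: eq_big => [w|w _]; last by rewrite mulrC mul_polyC.
  rewrite /good_perm sl /=; apply: eq_forallb => i.
  by rewrite inE nth_pwordS nth_pword_widen.
rewrite /weak_sum /word_sum -sumrB big_seq [RHS]big_seq; apply: eq_bigr => w.
rewrite mem_words => /andP[/eqP sw _].
by rewrite -mulr_suml (sum_good_perm _ (fun D => 'X^#|D|)) -weak_weight_compat // xw_polyC; ring.
Qed.

End Permutations.

Lemma smirnov_recursion_trunc g (C : nat -> {poly fps}) n :
  (forall N, smirnov_recursion (fun k => trunc N (g k))
               (fun i => map_poly (trunc N) (C i)) n) ->
  smirnov_recursion g C n.
Proof.
move=> h; apply/polyP => d; apply: trunc_inj => N.
have geom j : map_poly (trunc N) (tgeom fps j) = tgeom fps j.
  by rewrite /tgeom rmorph_sum /=; apply: eq_bigr => l _; rewrite map_polyXn.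
rewrite -!coef_map /= (h N) rmorphD rmorphM /= -deriv_map geom map_polyC /=.
rewrite rmorph_sum /=; congr (coefp d (_ + _)); apply: eq_bigr => j _.
by rewrite !rmorphM /= geom map_polyC.
Qed.

Lemma omega_pair_Wlt m : omega_pair_poly m.+1 (Wlt m.+1) (des_sum_lt m).
Proof.
have := @omega_pair_recursion m.+1 m.+1 (fun i => Wlt i.+1) des_sum_lt (leqnn _).
apply=> // i _; apply: smirnov_recursion_trunc => N.
  by have := strict_sum_recursion is_esym_esf N i; rewrite /smirnov_recursion;
    under eq_bigr do rewrite -trunc_Wlt; rewrite -trunc_Wlt.
by have := weak_sum_recursion is_esym_esf is_hsym_hsf N i; rewrite /smirnov_recursion;
    under eq_bigr do rewrite -trunc_des_sum_lt; rewrite -trunc_des_sum_lt.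
Qed.

Lemma map_poly_omega m p q : omega_pair_poly m p q -> map_poly omega p = q.
Proof.
move=> pq; apply/polyP => d.
rewrite coef_map_id0 ?(omega_pairE (pq d)) //.
(* [map_poly] acts only below the size of [p]; the remaining coefficients agree because omega 0 =
   0. *)
exact: omega_pairE (omega_pair_nat 0 0).
Qed.

(** * Reversal of words and permutations *)

Lemma xw_rev w : xw (rev w) = xw w.
Proof. by rewrite /xw; apply/perm_big; rewrite perm_rev. Qed.

Lemma xsum_rev (A B : set (seq nat)) : (forall w, A (rev w) <-> B w) -> xsum A = xsum B.
Proof.
move=> AB; apply/funext => m; rewrite /xsum (@reindex_fsbig _ _ _ _ _ rev B A).
  by apply: eq_fsbigr => w _; rewrite xw_rev.
split=> [w /AB //|v w _ _|w Aw]; first exact: (can_inj revK).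
by exists (rev w); [apply/AB; rewrite revK | rewrite revK].
Qed.

Lemma smirnov_rev n w : smirnov n w -> smirnov n (rev w).
Proof.
move=> [sw h]; split=> [|i]; first by rewrite size_rev.
have ilt := ltn_ord i; rewrite !nth_rev ?sw; [|lia|lia].
have jn : (n - i.+2 < n.-1)%N by lia.
have := h (Ordinal jn); rewrite /= eq_sym.
by rewrite (_ : (n - i.+2).+1 = n - i.+1)%N //; lia.
Qed.

(** Adjacent letters differ, so each of the m adjacent pairs is a descent in exactly one of the two
    words. *)
Lemma des_rev m w : smirnov m.+1 w -> (des (rev w) = m - des w)%N.
Proof.
move=> [sw h]; rewrite !desE size_rev sw /=.
suff e : (\sum_(p < m) (nth 0 (rev w) p.+1 < nth 0 (rev w) p) +
        \sum_(p < m) (nth 0 w p.+1 < nth 0 w p) = m)%N by rewrite -[X in _ = (X - _)%N]e addnK.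
rewrite (reindex_inj rev_ord_inj) -big_split /= -[RHS]card_ord -sum1_card.
apply: eq_bigr => p _; have pm := ltn_ord p.
rewrite !nth_rev ?sw; [|lia|lia].
rewrite (_ : m.+1 - (m - p.+1).+2 = p)%N; last lia.
rewrite (_ : m.+1 - (m - p.+1).+1 = p.+1)%N; last lia.
by have := h p; case: ltngtP.
Qed.

Section Reversal.
Variable m : nat.
Implicit Types s : 'S_m.+1.

Lemma head_rev (w : seq nat) : head 0%N (rev w) = last 0%N w.
Proof. by case/lastP: w => // w i; rewrite rev_rcons last_rcons. Qed.

Lemma last_rev (w : seq nat) : last 0%N (rev w) = head 0%N w.
Proof. by rewrite -head_rev revK. Qed.

Lemma coef_Wgt d : (d < m.+1)%N -> (Wgt m.+1)`_d = (Wlt m.+1)`_(m - d).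
Proof.
move=> dm; rewrite !coef_poly dm ltnS leq_subr.
apply: xsum_rev => w /=; rewrite head_rev last_rev; split=> [[sw [hl dw]]|[sw [hl dw]]].
  have sw' : smirnov m.+1 w by rewrite -[w]revK; apply: smirnov_rev.
  by split=> //; split=> //; rewrite -[w]revK (@des_rev m) ?dw.
by split; [exact: smirnov_rev | rewrite (@des_rev m) // dw; split=> //; lia].
Qed.

Lemma smirnov_pword s : smirnov m.+1 (pword s).
Proof.
split=> [|i]; first exact: size_pword.
rewrite nth_pwordS nth_pword_widen (inj_eq val_inj) (inj_eq perm_inj).
by rewrite -val_eqE [val (lift _ _)]lift0 /= neq_ltn ltnSn.
Qed.

Definition rev_perm : 'S_m.+1 := perm (@rev_ord_inj m.+1).

Lemma pword_rev s : pword (rev_perm * s)%g = rev (pword s).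
Proof.
apply: (@eq_from_nth _ 0%N); rewrite ?size_rev ?size_pword // => i im.
rewrite nth_rev ?size_pword // -[i]/(nat_of_ord (Ordinal im)) nth_pword permM permE.
by rewrite -nth_pword.
Qed.

(** Reversing the word of s complements the values of its inverse, which turns drops by at least 2
    into rises by at least 2. *)
Lemma ASCge2_rev s : ASCge2 ((rev_perm * s)^-1)%g = DESge2 (s^-1)%g.
Proof.
have rE (i : 'I_m.+1) : ((rev_perm * s)^-1)%g i = (m - (s^-1)%g i)%N :> nat.
  have -> : ((rev_perm * s)^-1)%g i = rev_ord ((s^-1)%g i).
    by apply: (@perm_inj _ (rev_perm * s)%g); rewrite permKV permM permE rev_ordK permKV.
  by rewrite /= subSS.
apply/finset.setP => i; rewrite !inE !nth_pwordS !nth_pword_widen !rE.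
have := ltn_ord ((s^-1)%g (lift ord0 i)).
have := ltn_ord ((s^-1)%g (widen_ord (leqnSn m) i)); lia.
Qed.

Definition des_sum_gt : {poly fps} :=
  \sum_(s : 'S_m.+1 | (head 0%N (pword s) > last 0%N (pword s))%N)
      Fqsym (ASCge2 (s^-1)%g) *: 'X^(des (pword s)).

Lemma coef_des_sum_gt d : (d < m.+1)%N -> des_sum_gt`_d = (des_sum_lt m)`_(m - d).
Proof.
move=> dm; rewrite /des_sum_gt /des_sum_lt (reindex_inj (mulgI rev_perm)) !coef_sum.
apply: eq_big => [s|s _]; first by rewrite pword_rev head_rev last_rev.
rewrite pword_rev (@des_rev m); last exact: smirnov_pword.
rewrite ASCge2_rev !coefZ !coefXn; congr (_ * (nat_of_bool _)%:R).
by have := des_le (pword s); rewrite size_pword /=; move: (des _) => k; lia.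
Qed.

Lemma size_des_sum_gt d : (m < d)%N -> des_sum_gt`_d = 0.
Proof.
move=> md; rewrite coef_sum big1 // => s _; rewrite coefZ coefXn.
have := des_le (pword s); rewrite size_pword /= => h.
by rewrite gtn_eqF ?mulr0 // (leq_ltn_trans h).
Qed.

End Reversal.

Theorem theorem5p1 (n : nat) (hn : (1 <= n)%N) :
  map_poly omega (Wlt n) =
    \sum_(s : 'S_n | (head 0 (pword s) < last 0 (pword s))%N)
      Fqsym (DESge2 (s^-1)%g) *: 'X^(des (pword s))
  /\
  map_poly omega (Wgt n) =
    \sum_(s : 'S_n | (head 0 (pword s) > last 0 (pword s))%N)
      Fqsym (ASCge2 (s^-1)%g) *: 'X^(des (pword s)).
Proof.
case: n hn => // m _; split; apply: (@map_poly_omega m.+1).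
  exact: omega_pair_Wlt.
rewrite -/(des_sum_gt m) => d; case: (ltnP d m.+1) => dm.
  (* Reversal replaces degree d by m - d on both sides, so the second identity is the first with its
     coefficients in reverse order. *)
  by rewrite coef_Wgt // coef_des_sum_gt //; apply: omega_pair_Wlt.
rewrite size_des_sum_gt // coef_poly ltnNge dm /=.
exact: (omega_pair_nat _ 0).
Qed.
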